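(* Let $\mathfrak{L}\in\{\mathfrak{d}_4,\mathfrak{b}_3\}$ and let $\varepsilon,\varepsilon'$ be two admissible graded contractions of the $\mathbb{Z}_2^3$-grading $\Gamma_{\mathfrak{L}}$. Then $\varepsilon\approx\varepsilon'$ (strong equivalence) if and only if $\varepsilon\sim_n\varepsilon'$ (equivalence by normalization).
   Context: **Octonions and gradings.** The lines of the Fano plane on $\{1,\dots,7\}$ are $\mathbf{L}=\{(1,2,5),(5,6,7),(7,4,1),(1,3,6),(6,4,2),(2,7,3),(3,4,5)\}$. $\mathcal{O}$ is the complex octonion algebra with basis $e_0=1,e_1,\dots,e_7$, $e_i^2=-1$ for $i\neq 0$, and $e_ie_j=-e_je_i=e_k$ whenever $(i,j,k)$ is a cyclic permutation of an element of $\mathbf{L}$. $n$ is the symmetric bilinear form with $n(e_i,e_j)=\delta_{ij}$. $\mathfrak{d}_4=\mathfrak{so}(\mathcal{O},n)=\{f\in\mathfrak{gl}(\mathcal{O}): n(f(x),y)+n(x,f(y))=0\ \forall x,y\}$ and $\mathfrak{b}_3=\{f\in\mathfrak{d}_4: f(1)=0\}$. Let $G=\mathbb{Z}_2^3$ with neutral element $e$, and $g_0=(0,0,0)$, $g_1=(1,0,0)$, $g_2=(0,1,0)$, $g_3=(0,0,1)$, $g_4=(1,1,1)$, $g_5=(1,1,0)$, $g_6=(1,0,1)$, $g_7=(0,1,1)$. $\mathcal{O}$ is $G$-graded by $\mathcal{O}_{g_i}=\mathbb{C}e_i$. $\Gamma_{\mathfrak{L}}$ is the $G$-grading $\mathfrak{L}=\bigoplus_{g\in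 G}\mathfrak{L}_g$ with $\mathfrak{L}_g=\{f\in\mathfrak{L}: f(\mathcal{O}_h)\subseteq\mathcal{O}_{g+h}\ \forall h\in G\}$. **Graded contractions.** A graded contraction of $\Gamma_{\mathfrak{L}}$ is a map $\varepsilon\colon G\times G\to\mathbb{C}$ such that the vector space $\mathfrak{L}$ with product $[x,y]^\varepsilon:=\varepsilon(g,h)[x,y]$ ($x\in\mathfrak{L}_g$, $y\in\mathfrak{L}_h$) is a Lie algebra, denoted $\mathfrak{L}^\varepsilon$. It is admissible if $\varepsilon(g,g)=\varepsilon(e,g)=\varepsilon(g,e)=0$ for all $g\in G$. $\varepsilon\approx\varepsilon'$ means there is a Lie algebra isomorphism $f\colon\mathfrak{L}^\varepsilon\to\mathfrak{L}^{\varepsilon'}$ with $f(\mathfrak{L}_g)=\mathfrak{L}_g$ for all $g\in G$. $\varepsilon\sim_n\varepsilon'$ means there is a map $\alpha\colon G\to\mathbb{C}^\times$ with $\varepsilon'(g,h)=\varepsilon(g,h)\dfrac{\alpha(g)\alpha(h)}{\alpha(g+h)}$ for all $g,h\in G$. *)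

(* Defs.v *)
From HB Require Import structures.
From mathcomp Require Import all_boot all_order all_algebra.
From mathcomp Require Import boolp classical_sets.
From mathcomp Require Export reals.
From mathcomp Require Export complex.

Set Implicit Arguments.
Unset Strict Implicit.
Unset Printing Implicit Defensive.

Import GRing.Theory.
Local Open Scope ring_scope.

Notation Z2_3 := ('Z_2 * 'Z_2 * 'Z_2)%type.

Definition gdeg (i : 'I_8) : Z2_3 :=
  nth 0 [:: (0, 0, 0); (1, 0, 0); (0, 1, 0); (0, 0, 1);
            (1, 1, 1); (1, 1, 0); (1, 0, 1); (0, 1, 1)] i.

Lemma gdeg_inj : injective gdeg.
Proof.
move=> [[|[|[|[|[|[|[|[|//]]]]]]]] i] [[|[|[|[|[|[|[|[|//]]]]]]]] j] /eqP //= _;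
by apply/val_inj.
Qed.

Lemma gdeg_surj (g : Z2_3) : exists i, gdeg i = g.
Proof.
have: g \in codom gdeg by apply: inj_card_onto; [exact: gdeg_inj|rewrite !card_prod !card_ord].
by case/codomP => i ->; exists i.
Qed.

Lemma addGG (g : Z2_3) : g + g = 0.
Proof.
by case: g => [[]] [[|[|//]] a] [[|[|//]] b] [[|[|//]] c]; apply/eqP.
Qed.

(* The octonion algebra: coordinate i of a row vector is the coefficient of
   e_i, so that e_0 is the unit. *)
Notation Oct F := 'rV[F]_8.
Notation gl F := 'End(Oct F).

Definition oe (F : fieldType) (i : 'I_8) : Oct F := delta_mx 0 i.

Definition fano : seq (nat * nat * nat) :=
  [:: (1, 2, 5); (5, 6, 7); (7, 4, 1); (1, 3, 6);
      (6, 4, 2); (2, 7, 3); (3, 4, 5)]%N.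

Definition on_line (i j k : nat) : bool :=
  [|| (i, j, k) \in fano, (j, k, i) \in fano | (k, i, j) \in fano].

Definition oe_mul (F : fieldType) (i j : 'I_8) : Oct F :=
  if i == 0 then oe F j
  else if j == 0 then oe F i
  else if i == j then - oe F 0
  else \sum_(k < 8 | on_line i j k) oe F k
       - \sum_(k < 8 | on_line j i k) oe F k.

Definition oct_mul (F : fieldType) (x y : Oct F) : Oct F :=
  \sum_(i < 8) \sum_(j < 8) (x 0 i * y 0 j) *: oe_mul F i j.

Definition oct_form (F : fieldType) (x y : Oct F) : F :=
  \sum_(i < 8) x 0 i * y 0 i.

(* As gdeg is injective, the sum has at most one term: see Ograd_gdeg. *)
Definition Ograd (F : fieldType) (g : Z2_3) : {vspace Oct F} :=
  (\sum_(i < 8 | gdeg i == g) <[oe F i]>)%VS.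

Lemma Ograd_gdeg (F : fieldType) (i : 'I_8) : Ograd F (gdeg i) = <[oe F i]>%VS.
Proof. by rewrite /Ograd (big_pred1 i) // => j; apply: inj_eq gdeg_inj _ _. Qed.

Lemma oe_mul_grad (F : fieldType) (i j : 'I_8) :
  oe_mul F i j \in Ograd F (gdeg i + gdeg j).
Proof.
have mem_sum (P : pred 'I_8) g : (forall k, P k -> gdeg k = g) ->
    \sum_(k < 8 | P k) oe F k \in Ograd F g.
  move=> Pg; apply: memv_suml => k /Pg <-.
  by rewrite Ograd_gdeg memv_line.
rewrite /oe_mul.
have [->|i0] := eqVneq i 0.
  by rewrite [gdeg 0](_ : _ = 0) // add0r Ograd_gdeg memv_line.
have [->|j0] := eqVneq j 0.
  by rewrite [gdeg 0](_ : _ = 0) // addr0 Ograd_gdeg memv_line.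
have [->|ij] := eqVneq i j.
  rewrite addGG rpredN; have <- : gdeg 0 = 0 by [].
  by rewrite Ograd_gdeg memv_line.
have line a b k : on_line a b k -> forall (x y z : 'I_8),
    x = a :> nat -> y = b :> nat -> z = k :> nat ->
    gdeg z = gdeg x + gdeg y.
  rewrite /on_line !inE !xpair_eqE => H x y z; move: H => /[swap] <- /[swap] <-.
  move=> /[swap] <-; rewrite /gdeg.
  by repeat (case/orP=> [|]); do 7?[by case/andP=> /andP [] /eqP -> /eqP -> /eqP ->; apply/eqP].
by rewrite rpredB // mem_sum // => k /line; [|rewrite addrC]; apply.
Qed.

Definition oproj (F : fieldType) (g : Z2_3) (x : Oct F) : Oct F :=
  \row_i (if gdeg i == g then x 0 i else 0).

Lemma oproj_is_linear (F : fieldType) (g : Z2_3) : linear (@oproj F g).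
Proof.
by move=> a x y; apply/rowP => i; rewrite !mxE; case: ifP => // _; rewrite mulr0 addr0.
Qed.

HB.instance Definition _ (F : fieldType) (g : Z2_3) :=
  GRing.isLinear.Build F (Oct F) (Oct F) _ (@oproj F g) (@oproj_is_linear F g).

Lemma oproj_in (F : fieldType) (g : Z2_3) (x : Oct F) : oproj g x \in Ograd F g.
Proof.
have -> : oproj g x = \sum_(i < 8 | gdeg i == g) x 0 i *: oe F i.
  rewrite [LHS]row_sum_delta [RHS]big_mkcond; apply: eq_bigr => i _.
  by rewrite mxE; case: ifP => // _; rewrite scale0r.
by apply: memv_sumr => i _; rewrite memvZ ?memv_line.
Qed.

Lemma mem_OgradP (F : fieldType) (g : Z2_3) (x : Oct F) :
  reflect (oproj g x = x) (x \in Ograd F g).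
Proof.
apply: (iffP idP) => [|<-]; last exact: oproj_in.
have [i <-] := gdeg_surj g; rewrite Ograd_gdeg => /vlineP [a ->].
rewrite linearZ; congr (_ *: _); apply/rowP => j; rewrite !mxE /=.
rewrite (inj_eq gdeg_inj); case: eqP => //.
Qed.

Lemma oproj_neq (F : fieldType) (g h : Z2_3) (x : Oct F) :
  g != h -> oproj g (oproj h x) = 0.
Proof.
move=> gh; apply/rowP => i; rewrite !mxE; case: eqP => // ->.
by rewrite (negbTE gh).
Qed.

Lemma sum_oproj (F : fieldType) (x : Oct F) : \sum_g oproj g x = x.
Proof.
apply/rowP => i; rewrite summxE (bigD1 (gdeg i)) //= big1 ?addr0.
  by rewrite mxE eqxx.
by move=> g; rewrite mxE eq_sym => /negbTE ->.
Qed.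

Lemma oct_formDl (F : fieldType) (x y z : Oct F) :
  oct_form (x + y) z = oct_form x z + oct_form y z.
Proof. by rewrite -big_split; apply: eq_bigr => i _; rewrite mxE mulrDl. Qed.

Lemma oct_formC (F : fieldType) (x y : Oct F) : oct_form x y = oct_form y x.
Proof. by apply: eq_bigr => i _; rewrite mulrC. Qed.

Lemma oct_formZl (F : fieldType) a (x y : Oct F) :
  oct_form (a *: x) y = a * oct_form x y.
Proof. by rewrite big_distrr /=; apply: eq_bigr => i _; rewrite mxE mulrA. Qed.

Lemma oct_form0l (F : fieldType) (y : Oct F) : oct_form 0 y = 0.
Proof. by apply: big1 => i _; rewrite mxE mul0r. Qed.

Lemma oct_form_suml (F : fieldType) (I : finType) (x : I -> Oct F) y :
  oct_form (\sum_i x i) y = \sum_i oct_form (x i) y.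
Proof.
elim/big_rec2: _ => [|i a b _ <-]; first exact: oct_form0l.
exact: oct_formDl.
Qed.

Lemma oct_form_proj (F : fieldType) (g : Z2_3) (x y : Oct F) :
  oct_form (oproj g x) y = oct_form x (oproj g y).
Proof.
by apply: eq_bigr => i _; rewrite !mxE; case: ifP => // _; rewrite mul0r mulr0.
Qed.

Variant so_kind := D4 | B3.

Definition in_d4 (F : fieldType) (f : gl F) : Prop :=
  forall x y : Oct F, oct_form (f x) y + oct_form x (f y) = 0.

Definition in_b3 (F : fieldType) (f : gl F) : Prop :=
  in_d4 f /\ f (oe F 0) = 0.

Definition in_so (F : fieldType) (k : so_kind) : {pred gl F} :=
  fun f => `[< match k with D4 => in_d4 f | B3 => in_b3 f end >].

Lemma in_soP (F : fieldType) (k : so_kind) (f : gl F) :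
  f \in in_so k <-> in_d4 f /\ (k = B3 -> f (oe F 0) = 0).
Proof.
split=> [/asboolP|[d4 b3]]; first by case: k => [d4|[d4 f0]]; split.
by apply/asboolP; case: k b3 => [_|b3] //; split=> //; apply: b3.
Qed.

Lemma in_so_submod (F : fieldType) (k : so_kind) : submod_closed (@in_so F k).
Proof.
split=> [|a f g /in_soP [f4 f3] /in_soP [g4 g3]]; apply/in_soP.
  split=> [x y|_]; last by rewrite zero_lfunE.
  by rewrite !zero_lfunE oct_form0l oct_formC oct_form0l addr0.
split=> [x y|kB]; rewrite !add_lfunE !scale_lfunE; last first.
  by rewrite f3 // g3 // scaler0 addr0.
rewrite oct_formDl oct_formZl [oct_form x _]oct_formC oct_formDl oct_formZl.
by rewrite addrACA -mulrDr ![oct_form _ x]oct_formC f4 g4 mulr0 addr0.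
Qed.

HB.instance Definition _ (F : fieldType) (k : so_kind) :=
  GRing.isSubmodClosed.Build F (gl F) (@in_so F k) (in_so_submod F k).

Record so_alg (F : fieldType) (k : so_kind) :=
  SoAlg { so_val :> gl F; so_valP : so_val \in in_so k }.

HB.instance Definition _ (F : fieldType) (k : so_kind) :=
  [isSub for @so_val F k].
HB.instance Definition _ (F : fieldType) (k : so_kind) :=
  [Choice of so_alg F k by <:].
HB.instance Definition _ (F : fieldType) (k : so_kind) :=
  [SubChoice_isSubLmodule of so_alg F k by <:].

Lemma so_brP (F : fieldType) (k : so_kind) (x y : so_alg F k) :
  ((x \o y) - (y \o x))%VF \in in_so k.
Proof.
have /in_soP [x4 x3] := so_valP x; have /in_soP [y4 y3] := so_valP y.
apply/in_soP; split=> [u v|kB]; rewrite !add_lfunE !opp_lfunE !comp_lfunE; last first.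
  by rewrite x3 // y3 // !linear0 addr0.
have formBl a b c : oct_form (a - b) c = oct_form a c - oct_form b c :> F.
  by rewrite oct_formDl -scaleN1r oct_formZl mulN1r.
have skew (z : so_alg F k) a b : in_d4 z -> oct_form (z a) b = - oct_form a (z b).
  by move=> z4; apply/eqP; rewrite -addr_eq0 z4.
rewrite formBl [oct_form u _]oct_formC formBl !(oct_formC _ u).
by rewrite !skew // !opprK addrC subrKA subrr.
Qed.

Definition so_br (F : fieldType) (k : so_kind) (x y : so_alg F k) : so_alg F k :=
  SoAlg (so_brP x y).

Definition Lgrad (F : fieldType) (k : so_kind) (g : Z2_3) : set (so_alg F k) :=
  [set x | forall h (v : Oct F), v \in Ograd F h -> x v \in Ograd F (g + h)].
Arguments Lgrad F k g : clear implicits.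

Definition hcomp (F : fieldType) (g : Z2_3) (f : gl F) : gl F :=
  \sum_h (linfun (@oproj F (g + h)) \o f \o linfun (@oproj F h))%VF.

Lemma hcompE (F : fieldType) (g : Z2_3) (f : gl F) (x : Oct F) :
  hcomp g f x = \sum_h oproj (g + h) (f (oproj h x)).
Proof.
by rewrite sum_lfunE; apply: eq_bigr => h _; rewrite !comp_lfunE !lfunE.
Qed.

Lemma hcompP (F : fieldType) (k : so_kind) (g : Z2_3) (x : so_alg F k) :
  hcomp g x \in in_so k.
Proof.
have /in_soP [x4 x3] := so_valP x; apply/in_soP; split=> [u v|kB]; last first.
  rewrite hcompE big1 // => h _.
  have e0 : oe F 0 \in Ograd F 0.
    by have <- : gdeg 0 = 0 by []; rewrite Ograd_gdeg memv_line.
  have [->|h0] := eqVneq h 0.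
    by rewrite (mem_OgradP _ _ e0) x3 // linear0.
  by rewrite -(mem_OgradP _ _ e0) oproj_neq // !linear0.
rewrite !hcompE [oct_form u _]oct_formC !oct_form_suml.
have inv : involutive (fun h : Z2_3 => g + h) by move=> h; rewrite addrA addGG add0r.
rewrite [X in _ + X](reindex_inj (inv_inj inv)) /= -big_split /=.
apply: big1 => h _; rewrite inv !oct_form_proj.
by rewrite [X in _ + X]oct_formC x4.
Qed.

(* The component of degree g of x: see so_comp_in and sum_so_comp. *)
Definition so_comp (F : fieldType) (k : so_kind) (g : Z2_3) (x : so_alg F k) :
  so_alg F k := SoAlg (hcompP g x).

Lemma so_comp_in (F : fieldType) (k : so_kind) (g : Z2_3) (x : so_alg F k) :
  Lgrad F k g (so_comp g x).
Proof.
move=> h v vh /=; rewrite hcompE (bigD1 h) //= big1 ?addr0 ?oproj_in //.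
by move=> i ih; rewrite -(mem_OgradP _ _ vh) oproj_neq // !linear0.
Qed.

Lemma sum_so_comp (F : fieldType) (k : so_kind) (x : so_alg F k) :
  \sum_g so_comp g x = x.
Proof.
apply/val_inj/lfunP => v; rewrite raddf_sum sum_lfunE /=.
under eq_bigr do rewrite hcompE.
rewrite exchange_big /= -[in RHS](sum_oproj v) linear_sum; apply: eq_bigr => h _.
have inv : involutive (fun g : Z2_3 => g + h).
  by move=> g; rewrite -addrA addGG addr0.
rewrite (reindex_inj (inv_inj inv)) /= -[RHS]sum_oproj.
by apply: eq_bigr => g _; rewrite -addrA addGG addr0.
Qed.

Lemma so_comp_homog (F : fieldType) (k : so_kind) (g h : Z2_3) (x : so_alg F k) :
  Lgrad F k g x -> so_comp h x = if h == g then x else 0.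
Proof.
move=> xg; apply/val_inj/lfunP => v /=; rewrite hcompE; case: eqP => [->|/eqP hg].
  rewrite -[in RHS](sum_oproj v) linear_sum; apply: eq_bigr => i _.
  by apply/mem_OgradP/xg; exact: oproj_in.
rewrite zero_lfunE big1 // => i _.
rewrite -(mem_OgradP _ _ (xg _ _ (oproj_in i v))) oproj_neq //.
by rewrite (inj_eq (addIr i)).
Qed.

(* Bilinear extension of eps g h *: [x, y] for x, y homogeneous of degrees g, h:
   see contr_br_homog. *)
Definition contr_br (F : fieldType) (k : so_kind) (eps : Z2_3 -> Z2_3 -> F)
    (x y : so_alg F k) : so_alg F k :=
  \sum_g \sum_h eps g h *: so_br (so_comp g x) (so_comp h y).

Lemma so_br0l (F : fieldType) (k : so_kind) (y : so_alg F k) : so_br 0 y = 0.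
Proof. by apply/val_inj; rewrite /= comp_lfun0l comp_lfun0r subr0. Qed.

Lemma so_br0r (F : fieldType) (k : so_kind) (y : so_alg F k) : so_br y 0 = 0.
Proof. by apply/val_inj; rewrite /= comp_lfun0l comp_lfun0r subr0. Qed.

Lemma contr_br_homog (F : fieldType) (k : so_kind) (eps : Z2_3 -> Z2_3 -> F)
    (g h : Z2_3) (x y : so_alg F k) :
  Lgrad F k g x -> Lgrad F k h y -> contr_br eps x y = eps g h *: so_br x y.
Proof.
move=> xg yh; rewrite /contr_br (bigD1 g) //= [X in _ + X]big1 => [|i ig].
  rewrite addr0 (bigD1 h) //= [X in _ + X]big1 => [|j jh].
    by rewrite addr0 (so_comp_homog _ xg) (so_comp_homog _ yh) !eqxx.
  by rewrite (so_comp_homog _ yh) (negbTE jh) so_br0r scaler0.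
apply: big1 => j _.
by rewrite (so_comp_homog _ xg) (negbTE ig) so_br0l scaler0.
Qed.

Definition is_lie_bracket (F : fieldType) (V : lmodType F) (b : V -> V -> V) : Prop :=
  [/\ forall y, linear (b ^~ y), forall x, linear (b x),
      forall x, b x x = 0
    & forall x y z, b x (b y z) + b y (b z x) + b z (b x y) = 0].

Definition is_lie_isom (F : fieldType) (V W : lmodType F)
    (b : V -> V -> V) (b' : W -> W -> W) (f : V -> W) : Prop :=
  [/\ linear f, bijective f & forall x y, f (b x y) = b' (f x) (f y)].

Definition graded_contraction (F : fieldType) (k : so_kind)
    (eps : Z2_3 -> Z2_3 -> F) : Prop :=
  is_lie_bracket (@contr_br F k eps).

Definition admissible (F : fieldType) (eps : Z2_3 -> Z2_3 -> F) : Prop :=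
  forall g, [/\ eps g g = 0, eps 0 g = 0 & eps g 0 = 0].

Definition strong_equiv (F : fieldType) (k : so_kind)
    (eps eps' : Z2_3 -> Z2_3 -> F) : Prop :=
  exists f : so_alg F k -> so_alg F k,
    is_lie_isom (contr_br eps) (contr_br eps') f /\
    forall g, (f @` Lgrad F k g = Lgrad F k g)%classic.

Definition norm_equiv (F : fieldType) (eps eps' : Z2_3 -> Z2_3 -> F) : Prop :=
  exists alpha : Z2_3 -> F, (forall g, alpha g != 0) /\
    forall g h, eps' g h = eps g h * (alpha g * alpha h / alpha (g + h)).

(* Main.v *)
(* Write g, h, g + h for the three points of a line of the Fano plane. After a
   linear change of coordinates the bracket L_g x L_h -> L_{g+h} is the
   componentwise product of F^4 (for d4) or F^3 (for b3). A graded isomorphism f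
   which does not kill this bracket is an isotopism of that product, hence acts
   on the three components as monomial matrices with a common permutation, with
   entries a_g, a_h, a_{g+h} satisfying eps(g,h) a_{g+h} = +-eps'(g,h) a_g a_h.
   When two lines through g are involved, f is monomial on L_g for two different
   coordinate systems, which forces it to be a similitude, so a_g^2 does not
   depend on the line. Thus eps and eps' agree up to normalization and up to a
   sign s depending only on the line.

   It remains to write s as a normalization on the support of eps. The Jacobi
   identity for independent triples links the signs of the four lines missing a
   point p: either their product is 1, or one of them misses the support, or the
   support consists of pairs in the complement of a line through p. If the last
   case occurs for no p, then s is a word of the (punctured) Hamming code and is
   normalized by signs; if it does, square roots of signs are needed. *)

From HB Require Import structures.
Require Import Defs.
From mathcomp Require Import all_boot all_order all_algebra.
From mathcomp Require Import boolp classical_sets ring.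

Set Implicit Arguments.
Unset Strict Implicit.
Unset Printing Implicit Defensive.

Import Order.TTheory GRing.Theory Num.Theory.
Local Open Scope ring_scope.

(** * Points and lines of the Fano plane *)

(* Z_2^3 coded by booleans, so that closed statements on points compute. *)
Notation pt := (bool * bool * bool)%type.

Definition pts : seq pt :=
  [seq (xy, z) | xy <- [seq (x, y) | x <- [:: false; true], y <- [:: false; true]],
                 z <- [:: false; true]].

Lemma mem_pts (x : pt) : x \in pts.
Proof. by case: x => [[[] []] []]. Qed.

Lemma all_ptsP (P : pred pt) : all P pts -> forall x, P x.
Proof. by move=> /allP Pp x; apply/Pp/mem_pts. Qed.

Lemma all_pts3P (P : pt -> pt -> pt -> bool) :
  all (fun x => all (fun y => all (P x y) pts) pts) pts -> forall x y z, P x y z.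
Proof. by move=> /all_ptsP Px x y z; move: z; apply/all_ptsP; move: y; apply/all_ptsP. Qed.

Lemma addxx (x : pt) : x + x = 0.
Proof. by case: x => [[[] []] []]. Qed.

Lemma addKx (x y : pt) : x + (x + y) = y.
Proof. by rewrite addrA addxx add0r. Qed.

Definition indep (x y z : pt) : bool :=
  [&& x != 0, y != 0, x != y & z \notin [:: 0; x; y; x + y]].

(* The vector product over F_2: for x != y nonzero it encodes the line through
   x and y, as the nonzero n with n . x = n . y = 0. *)
Definition cross (x y : pt) : pt :=
  ((x.1.2 && y.2) (+) (x.2 && y.1.2), (x.2 && y.1.1) (+) (x.1.1 && y.2),
   (x.1.1 && y.1.2) (+) (x.1.2 && y.1.1)).

Definition dot (x y : pt) : bool :=
  (x.1.1 && y.1.1) (+) (x.1.2 && y.1.2) (+) (x.2 && y.2).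

Definition line_pairs (x y : pt) : seq (pt * pt) :=
  [:: (x, y); (y, x); (x, x + y); (x + y, x); (y, x + y); (x + y, y)].

Lemma cross_eq (x y x' y' : pt) : cross x y != 0 -> cross x' y' = cross x y ->
  (x', y') \in line_pairs x y.
Proof.
pose P x y x' y' := (cross x y != 0) ==> (cross x' y' == cross x y) ==>
  ((x', y') \in line_pairs x y).
suff /all_ptsP/(_ x)/all_ptsP/(_ y)/all_ptsP/(_ x')/all_ptsP/(_ y') :
    all (fun x => all (fun y => all (fun x' => all (P x y x') pts) pts) pts) pts.
  by move=> /implyP H /H /implyP H' /eqP.
by vm_compute.
Qed.

Lemma cross_neq0 (x y : pt) : (cross x y != 0) = [&& x != 0, y != 0 & x != y].
Proof. by case: x y => [[[] []] []] [[[] []] []]. Qed.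

Lemma crossxD (x y : pt) : cross x (x + y) = cross x y.
Proof. by case: x y => [[[] []] []] [[[] []] []]. Qed.

Lemma crossC (x y : pt) : cross x y = cross y x.
Proof. by case: x y => [[[] []] []] [[[] []] []]. Qed.

(** Symmetry and passage to the third point generate all changes of a pair on a line, so such a
    function depends only on the line: see [line_fun_cross]. *)
Definition line_fun (T : Type) (s : pt -> pt -> T) : Prop :=
  (forall x y, s x y = s y x) /\ (forall x y, s x (x + y) = s x y).

Lemma line_fun_cross (T : Type) (s : pt -> pt -> T) x y x' y' :
  line_fun s -> cross x y != 0 -> cross x' y' = cross x y -> s x' y' = s x y.
Proof.
move=> [sC sD] n0 /(cross_eq n0); rewrite !inE !xpair_eqE.
have sD' a b : s b (a + b) = s a b by rewrite addrC sD sC.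
by do 5?[case/orP]; move=> /andP[/eqP-> /eqP->]; rewrite // 1?sC ?sD' ?sD 1?sC.
Qed.

Lemma cross_surj n : {xy : pt * pt | cross xy.1 xy.2 = n}.
Proof.
pose l := [seq xy <- [seq (x, y) | x <- pts, y <- pts] | cross xy.1 xy.2 == n].
by exists (head 0 l); apply/eqP; rewrite {}/l; case: n => [[[] []] []]; vm_compute.
Qed.

Definition line_rep (n : pt) : pt * pt := sval (cross_surj n).

Lemma line_repP n : cross (line_rep n).1 (line_rep n).2 = n.
Proof. exact: svalP (cross_surj n). Qed.

(** The linear map sending the standard basis [P1], [P2], [P4] to p, a, b; it moves an arbitrary
    frame to the standard one. *)
Definition span3 (p a b x : pt) : pt :=
  (if x.1.1 then p else 0) + (if x.1.2 then a else 0) + (if x.2 then b else 0).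

Lemma span3D p a b : {morph span3 p a b : x y / x + y}.
Proof.
move=> [[x1 x2] x3] [[y1 y2] y3].
have ifD (c d : bool) (z : pt) :
    (if c (+) d then z else 0) = (if c then z else 0) + (if d then z else 0).
  by case: c d => [] []; rewrite /= ?addxx ?addr0 ?add0r.
rewrite [LHS](_ : _ = (if x1 (+) y1 then p else 0) + (if x2 (+) y2 then a else 0)
  + (if x3 (+) y3 then b else 0)) //.
by rewrite /span3 /= !ifD [RHS]addrACA; congr (_ + _); rewrite addrACA.
Qed.

Lemma span3_0 p a b : span3 p a b 0 = 0.
Proof. by rewrite /span3 /= !addr0. Qed.

Lemma span3_inj p a b : indep p a b -> injective (span3 p a b).
Proof.
move=> i x y /eqP; pose P p a b x y := indep p a b ==>
  (span3 p a b x == span3 p a b y) ==> (x == y).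
suff /all_ptsP/(_ p)/all_ptsP/(_ a)/all_ptsP/(_ b)/all_ptsP/(_ x)/all_ptsP/(_ y) :
    all (fun p => all (fun a => all (fun b => all (fun x => all (P p a b x) pts) pts) pts) pts) pts.
  by rewrite /P i /= => /implyP h /h/eqP.
by vm_compute.
Qed.

Lemma indep_span3 p a b x y z : indep p a b ->
  indep (span3 p a b x) (span3 p a b y) (span3 p a b z) = indep x y z.
Proof.
move=> i; have I := inj_eq (span3_inj i).
by rewrite /indep !inE -span3D -(span3_0 p a b) !I.
Qed.

(** * Signs on lines *)

(* P_n is the point with binary digits n, so sums of points are xors of indices. *)
Local Notation P1 := (true, false, false).
Local Notation P2 := (false, true, false).
Local Notation P3 := (true, true, false).
Local Notation P4 := (false, false, true).
Local Notation P5 := (true, false, true).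
Local Notation P6 := (false, true, true).
Local Notation P7 := (true, true, true).

Section SignedCocycles.
Variable C : numClosedFieldType.
Implicit Types (e : pt -> pt -> C) (s : pt -> pt -> bool).

(* What remains of the Lie axioms for an admissible contraction: the Jacobi
   identity is vacuous on dependent triples. *)
Definition nice e : Prop :=
  [/\ forall x y, e x y = e y x, forall x, e x x = 0, forall x, e 0 x = 0
    & forall x y z, indep x y z -> e y z * e x (y + z) = e x y * e z (x + y)].

Definition signed s e : pt -> pt -> C := fun x y => (-1) ^+ s x y * e x y.

(** Multiplying both sides by e asks c to be a coboundary only on the support of e. *)
Definition coboundary_on e (c : pt -> pt -> C) : Prop :=
  exists a : pt -> C, (forall x, a x != 0) /\
    forall x y, e x y * c x y = e x y * (a x * a y / a (x + y)).

Lemma nice_span3 p a b e : indep p a b -> nice e ->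
  nice (fun x y => e (span3 p a b x) (span3 p a b y)).
Proof.
move=> i [eC e1 e0 eJ]; split=> // x y z xyz.
by rewrite !span3D eJ // indep_span3.
Qed.

Lemma coboundary_span3 p a b e c : indep p a b ->
  coboundary_on (fun x y => e (span3 p a b x) (span3 p a b y))
    (fun x y => c (span3 p a b x) (span3 p a b y)) ->
  coboundary_on e c.
Proof.
move=> i [al [al0 alE]].
have [g fK gK] := injF_bij (span3_inj i).
exists (al \o g); split=> [x|x y]; first exact: al0.
have gD : g (x + y) = g x + g y by apply: (can_inj fK); rewrite span3D !gK.
by have := alE (g x) (g y); rewrite !gK /= gD.
Qed.

Lemma signr_inj_num : injective (fun b : bool => (-1) ^+ b : C).
Proof.
have N : (1 == -1 :> C) = false by rewrite -addr_eq0 -[1 + 1]/(2%:R) pnatr_eq0.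
by move=> [] [] //= /eqP; rewrite expr0 expr1 ?N // eq_sym N.
Qed.

(** The Jacobi identities of e and of its signed version have the same terms up to sign; when one
    side is nonzero, dividing them leaves a relation between the signs. *)
Lemma nice_swap e s x y z : nice e -> nice (signed s e) -> indep x y z ->
  e x y != 0 -> e (x + y) z != 0 ->
  [/\ e y z != 0, e x (y + z) != 0
    & s x y (+) s z (x + y) = s y z (+) s x (y + z)].
Proof.
move=> [eC _ _ eJ] [_ _ _ sJ] xyz e1 e2.
have E := eJ _ _ _ xyz; have := sJ _ _ _ xyz.
rewrite /signed mulrACA [RHS]mulrACA -!signr_addb E.
have p0 : e x y * e z (x + y) != 0 by rewrite mulf_neq0 // [e z _]eC.
move=> /(mulIf p0)/signr_inj_num ->.
by move: p0; rewrite -E mulf_eq0 negb_or => /andP[].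
Qed.

(* Prescribed pairwise products of four unknowns are
   consistent as soon as the three complementary pairs have the same product;
   the values x, y, z on the targets are chosen to achieve this. *)
Lemma four_products (S1 S2 S3 S4 S5 S6 : bool) :
  exists x y z a a' b b' : C,
  [/\ [/\ x != 0, y != 0 & z != 0], [/\ a != 0, a' != 0, b != 0 & b' != 0],
      [/\ a * b / x = (-1) ^+ S1 & a' * b' / x = (-1) ^+ S2],
      [/\ a * b' / y = (-1) ^+ S3 & a' * b / y = (-1) ^+ S4]
    & [/\ a * a' / z = (-1) ^+ S5 & b * b' / z = (-1) ^+ S6]].
Proof.
have sq (S : bool) : ((-1) ^+ S : C) ^+ 2 = 1 by exact: sqrr_sign.
have s0 (S : bool) : (-1) ^+ S != 0 :> C by rewrite signr_eq0.
have rt (w : C) : w != 0 -> {x : C | x != 0 & x ^+ 2 = w}.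
  by move=> w0; exists (sqrtC w); rewrite ?sqrtC_eq0 // sqrtCK.
move: (sq S1) (sq S2) (sq S3) (sq S4) (sq S5) (sq S6).
move: (s0 S1) (s0 S2) (s0 S3) (s0 S4) (s0 S5) (s0 S6).
move: ((-1) ^+ S1) ((-1) ^+ S2) ((-1) ^+ S3) ((-1) ^+ S4) ((-1) ^+ S5) ((-1) ^+ S6).
move=> T1 T2 T3 T4 T5 T6 n1 n2 n3 n4 n5 n6 q1 q2 q3 q4 q5 q6.
(* With these squares, each of (ab)(a'b'), (ab')(a'b) and (aa')(bb') has to be 1. *)
have [x x0 xE] := rt _ (mulf_neq0 n1 n2).
have [y y0 yE] := rt _ (mulf_neq0 n3 n4).
have [z z0 zE] := rt _ (mulf_neq0 n5 n6).
(* The square of a is forced: it is (ab')(aa')/(a'b'). The other three unknowns then follow from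
   their products with a. *)
have w0 : T2 * T3 * T5 * (y * z / x) != 0 by rewrite !mulf_neq0 ?invr_eq0.
have [u u0 uE] := rt _ w0.
have ux : u ^+ 2 * x = T2 * T3 * T5 * y * z by rewrite uE; field.
exists x, y, z, u, (T5 * z / u), (T1 * x / u), (T3 * y / u).
have k (p q r : C) : r != 0 -> p = r * q -> p / r = q.
  by move=> r0 ->; rewrite mulrAC mulfV // mul1r.
have k2 (p q : C) : p * x = q * (u ^+ 2 * x) -> p / u ^+ 2 = q.
  move=> pq; apply: k; rewrite ?expf_neq0 //; apply: (mulIf x0).
  by rewrite pq; ring.
split; split; rewrite ?mulf_neq0 ?invr_eq0 //; apply: k => //.
- by field.
- rewrite [LHS](_ : _ = T5 * T3 * z * y / u ^+ 2); last by field.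
  apply: k2; rewrite ux -[LHS]mulr1 -q2; ring.
- by field.
- rewrite [LHS](_ : _ = T5 * T1 * z * x / u ^+ 2); last by field.
  apply: k2; rewrite ux.
  rewrite [LHS](_ : _ = T5 * T1 * z * x ^+ 2); last by ring.
  rewrite [RHS](_ : _ = T4 * T2 * T3 * T5 * z * y ^+ 2); last by ring.
  rewrite xE yE [LHS](_ : _ = T5 * T2 * z * T1 ^+ 2); last by ring.
  rewrite [RHS](_ : _ = T5 * T2 * z * T3 ^+ 2 * T4 ^+ 2); last by ring.
  by rewrite q1 q3 q4 !mulr1.
- by field.
- rewrite [LHS](_ : _ = T1 * T3 * x * y / u ^+ 2); last by field.
  apply: k2; rewrite ux.
  rewrite [LHS](_ : _ = T1 * T3 * y * x ^+ 2); last by ring.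
  rewrite [RHS](_ : _ = T6 * T2 * T3 * T5 * y * z ^+ 2); last by ring.
  rewrite xE zE [LHS](_ : _ = T2 * T3 * y * T1 ^+ 2); last by ring.
  rewrite [RHS](_ : _ = T2 * T3 * y * T5 ^+ 2 * T6 ^+ 2); last by ring.
  by rewrite q1 q5 q6 !mulr1.
Qed.

(** The total sign of the four lines missing p; it does not depend on a and b, see [xor4_swap]. *)
Definition xor4 s (p a b : pt) : bool :=
  s a b (+) s (a + p) (b + p) (+) s a (b + p) (+) s (a + p) b.

Definition quad_lines (p a b : pt) : seq pt :=
  [:: cross a b; cross (a + p) (b + p); cross a (b + p); cross (a + p) b].

Lemma quad_lines_neq0 p a b : indep p a b -> all (fun n => n != 0) (quad_lines p a b).
Proof.
apply/implyP; move: p a b; apply: all_pts3P; by vm_compute.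
Qed.

Lemma xor4E s p a b : line_fun s -> indep p a b ->
  xor4 s p a b = \big[addb/false]_(n <- quad_lines p a b) s (line_rep n).1 (line_rep n).2.
Proof.
move=> ls /quad_lines_neq0.
rewrite /quad_lines !big_cons big_nil addbF /xor4 [all _ _]/= => /and5P[n1 n2 n3 n4 _].
by rewrite -!addbA; do 3?[congr (_ (+) _)]; apply: line_fun_cross; rewrite ?line_repP.
Qed.

Lemma quad_lines_swap p a b x y : indep p a b -> indep p x y ->
  perm_eq (quad_lines p a b) (quad_lines p x y).
Proof.
pose P p a b x y := indep p a b ==> indep p x y ==>
  perm_eq (quad_lines p a b) (quad_lines p x y).
suff /all_ptsP/(_ p)/all_ptsP/(_ a)/all_ptsP/(_ b)/all_ptsP/(_ x)/all_ptsP/(_ y) :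
    all (fun p => all (fun a => all (fun b => all (fun x => all (P p a b x) pts) pts) pts) pts) pts.
  by move=> /implyP h /h /implyP.
by vm_compute.
Qed.

Lemma xor4_swap s p a b x y : line_fun s -> indep p a b -> indep p x y ->
  xor4 s p a b = xor4 s p x y.
Proof.
by move=> ls ab xy; rewrite !xor4E // (perm_big _ (quad_lines_swap ab xy)).
Qed.

(* The Jacobi identity for x, y, x + p involves the four lines missing p, once
   each. *)
Lemma quad_swap e s p a b x y : nice e -> nice (signed s e) -> line_fun s ->
  indep p a b -> xor4 s p a b -> indep p x y ->
  e x y != 0 -> e (x + y) (x + p) != 0 -> False.
Proof.
move=> ne ns ls pab X pxy exy exz.
have xyz : indep x y (x + p).
  move: pxy; apply/implyP; move: p x y {pab X exy exz}.
  by apply: all_pts3P; vm_compute.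
have [_ _] := nice_swap ne ns xyz exy exz; case: (ls) => sC sD.
move: X; rewrite (xor4_swap ls pab pxy) /xor4.
have -> : s (x + p) (y + p) = s (x + p) (x + y).
  by rewrite -[RHS]sD; congr (s _ _); rewrite [x + p]addrC -addrA addKx addrC.
have -> : s x (y + (x + p)) = s x (y + p) by rewrite addrCA sD.
by rewrite [s y _]sC; case: (s _ _); case: (s _ _); case: (s _ _); case: (s _ _).
Qed.

(** Since the total sign is odd, [quad_swap] and [nice_swap] make e vanish on every pair not
    contained in {P2, P3, P4, P5}, the complement of the line {P1, P6, P7}. The six remaining pairs
    are solved by [four_products]. *)
Lemma coboundary_quad_std e s : nice e -> nice (signed s e) -> line_fun s ->
  xor4 s P1 P2 P4 -> e P2 P4 != 0 -> e P3 P5 != 0 -> e P2 P5 != 0 -> e P3 P4 != 0 ->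
  coboundary_on e (fun x y => (-1) ^+ s x y).
Proof.
move=> ne ns ls X h24 h35 h25 h34.
have Q x y := @quad_swap e s P1 P2 P4 x y ne ns ls isT X.
have K x y z := @nice_swap e s x y z ne ns.
have ln x y x' y' := @line_fun_cross _ s x y x' y' ls.
have Xs : s P2 P4 (+) s P3 P5 (+) s P2 P5 (+) s P3 P4 by exact: X.
case: (ne) => eC e1 e0 _.
have [h42 h53 h52 h43] : [/\ e P4 P2 != 0, e P5 P3 != 0, e P5 P2 != 0 & e P4 P3 != 0].
  by rewrite ![e P4 _]eC ![e P5 _]eC.
have z x y : (e x y != 0 -> False) -> e x y = 0 /\ e y x = 0.
  by move=> h; rewrite [e y x]eC; split; apply/eqP/negPn/negP.
have [z26 z62] : e P2 P6 = 0 /\ e P6 P2 = 0 by apply: z => /(Q P2 P6 isT); apply.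
have [z46 z64] : e P4 P6 = 0 /\ e P6 P4 = 0 by apply: z => /(Q P4 P6 isT); apply.
have [z27 z72] : e P2 P7 = 0 /\ e P7 P2 = 0 by apply: z => /(Q P2 P7 isT); apply.
have [z57 z75] : e P5 P7 = 0 /\ e P7 P5 = 0 by apply: z => /(Q P5 P7 isT); apply.
have [z37 z73] : e P3 P7 = 0 /\ e P7 P3 = 0 by apply: z => /(Q P3 P7 isT); apply.
have [z47 z74] : e P4 P7 = 0 /\ e P7 P4 = 0 by apply: z => /(Q P4 P7 isT); apply.
have [z36 z63] : e P3 P6 = 0 /\ e P6 P3 = 0 by apply: z => /(Q P3 P6 isT); apply.
have [z56 z65] : e P5 P6 = 0 /\ e P6 P5 = 0 by apply: z => /(Q P5 P6 isT); apply.
have [z67 z76] : e P6 P7 = 0 /\ e P7 P6 = 0.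
  by apply: z => /(K P2 P4 P7 isT h24)[/eqP].
have s51 : s P5 P1 = s P4 P1 by exact: ln.
(* Otherwise two sign relations through [P1] add up to an even total sign, because
   [s P5 P1 = s P4 P1]. *)
have [z61 z16] : e P6 P1 = 0 /\ e P1 P6 = 0.
  apply: z => h; move: Xs.
  have [_ _ E1] := K P2 P4 P1 isT h24 h; have [_ _ E2] := K P3 P5 P1 isT h35 h.
  have {}E1 : s P2 P4 (+) s P1 P6 = s P4 P1 (+) s P2 P5 by exact: E1.
  have {}E2 : s P3 P5 (+) s P1 P6 = s P5 P1 (+) s P3 P4 by exact: E2.
  rewrite s51 in E2; move: E1 E2.
  by case: (s P1 P6); case: (s P2 P4) (s P4 P1) (s P2 P5) (s P3 P5) (s P3 P4) => [] [] [] [] [].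
have [z71 z17] : e P7 P1 = 0 /\ e P1 P7 = 0.
  apply: z => h; move: Xs.
  have [_ _ E1] := K P2 P5 P1 isT h25 h; have [_ _ E2] := K P3 P4 P1 isT h34 h.
  have {}E1 : s P2 P5 (+) s P1 P7 = s P5 P1 (+) s P2 P4 by exact: E1.
  have {}E2 : s P3 P4 (+) s P1 P7 = s P4 P1 (+) s P3 P5 by exact: E2.
  rewrite s51 in E1; move: E1 E2.
  by case: (s P1 P7); case: (s P2 P4) (s P4 P1) (s P2 P5) (s P3 P5) (s P3 P4) => [] [] [] [] [].
have [z12 z21] : e P1 P2 = 0 /\ e P2 P1 = 0.
  by apply: z => /(K P1 P2 P4 isT)/(_ h34)[_ /eqP].
have [z13 z31] : e P1 P3 = 0 /\ e P3 P1 = 0.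
  by apply: z => /(K P1 P3 P4 isT)/(_ h24)[_ /eqP].
have [z14 z41] : e P1 P4 = 0 /\ e P4 P1 = 0.
  by apply: z => /(K P1 P4 P2 isT)/(_ h52)[_ /eqP].
have [z15 z51] : e P1 P5 = 0 /\ e P5 P1 = 0.
  by apply: z => /(K P1 P5 P2 isT)/(_ h42)[_ /eqP].
have z0 x : e (false, false, false) x = 0 by exact: e0.
have z0' x : e x (false, false, false) = 0 by rewrite eC z0.
(* Complementary pairs have the same sum: P2 + P4 = P3 + P5 = P6, P2 + P5 = P3 + P4 = P7 and P2 + P3
   = P4 + P5 = P1. *)
have [x6 [x7 [x1 [x2 [x3 [x4 [x5 H]]]]]]] :=
  four_products (s P2 P4) (s P3 P5) (s P2 P5) (s P3 P4) (s P2 P3) (s P4 P5).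
case: H => -[x60 x70 x10] [x20 x30 x40 x50] [E24 E35] [E25 E34] [E23 E45].
pose al (x : pt) := match x with
  | P1 => x1 | P2 => x2 | P3 => x3 | P4 => x4 | P5 => x5 | P6 => x6 | P7 => x7 | _ => 1 end.
have alE x y : e x y = 0 \/ (-1) ^+ s x y = al x * al y / al (x + y).
  have [sC _] := ls.
  have sw a b : (-1) ^+ s a b = al a * al b / al (a + b) ->
      (-1) ^+ s b a = al b * al a / al (b + a).
    by rewrite [s b a]sC [al b * _]mulrC [b + a]addrC.
  move: E24 E35 E25 E34 E23 E45 => /esym E24 /esym E35 /esym E25 /esym E34 /esym E23 /esym E45.
  case: x y => [[[] []] []] [[[] []] []]; first
   [left; solve [exact: e1 | exact: z0 | exact: z0' | assumption]
   | right; first [exact: E24 | exact: E35 | exact: E25 | exact: E34 | exact: E23 | exact: E45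
     | apply: sw; first [exact: E24 | exact: E35 | exact: E25 | exact: E34 | exact: E23 | exact: E45]]].
exists al; split=> [[[[] []] []]|x y] //=; first exact: oner_neq0.
by case: (alE x y) => ->; rewrite ?mul0r.
Qed.

(** * Signs on marked lines and the punctured Hamming code *)

Fixpoint all_bits n (P : pred (seq bool)) : bool :=
  if n is m.+1 then
    if all_bits m (fun l => P (false :: l)) then all_bits m (fun l => P (true :: l)) else false
  else P [::].

Lemma all_bitsP n (P : pred (seq bool)) : reflect (forall l, size l = n -> P l) (all_bits n P).
Proof.
elim: n P => [|n IH] P /=; first by apply: (iffP idP) => [P0 [|//]|->].
apply: (iffP idP) => [|h].
  case: ifP => // /IH P0 /IH P1 [|b l] //= [/[dup] /P1 h1 /P0 h0].
  by case: b.
have -> : all_bits n (fun l => P (false :: l)).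
  by apply/IH => l sl; apply: h; rewrite /= sl.
by apply/IH => l sl; apply: h; rewrite /= sl.
Qed.

(* f lists the marks t, then the signs s, of the seven lines. The lines with
   n . p = 1 are those missing the point p; as they form the words of the dual
   of the Hamming code, only they can obstruct the solvability of s n = sum of
   l over the points of n, for n marked. Nested conditionals are used instead of
   the boolean connectives, which vm_compute does not evaluate lazily. *)
Definition hamming_check (f : seq bool) : bool :=
  let ix n := index n (behead pts) in
  let t n := nth false f (ix n) in
  let s n := nth false f (7 + ix n)%N in
  let sum P (g : pt -> bool) :=
    foldr (fun n b => (if P n then g n else false) (+) b) false (behead pts) in
  if ~~ all (fun n => if s n then t n else true) (behead pts) then true else
  if ~~ all (fun p => if has (fun n => if dot n p then ~~ t n else false) (behead pts)
       then true else ~~ sum (dot^~ p) s) (behead pts) then true else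
  ~~ all_bits 7 (fun l => ~~ all (fun n => if t n then
      sum (fun x => ~~ dot n x) (fun x => nth false l (ix x)) == s n else true) (behead pts)).

Lemma hamming_ok : all_bits 14 hamming_check.
Proof. by vm_compute. Qed.

(** The exhaustive check [hamming_ok], carried over from lists of 14 bits to functions on lines;
    [behead pts] lists the seven nonzero points. *)
Lemma hamming (t s : pt -> bool) : (forall n, s n -> t n) ->
  (forall p, p != 0 -> (forall n, dot n p -> t n) ->
     ~~ \big[addb/false]_(n <- [seq n <- behead pts | dot n p]) s n) ->
  exists c : pt -> bool, forall x y, cross x y != 0 -> t (cross x y) ->
    c x (+) c y (+) c (x + y) = s (cross x y).
Proof.
move=> st H; pose f := map t (behead pts) ++ map s (behead pts).
have sumE P g : foldr (fun n b => (if P n then g n else false) (+) b) false (behead pts)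
    = \big[addb/false]_(n <- [seq n <- behead pts | P n]) g n.
  by rewrite big_filter big_mkcond; elim: (behead pts) => [|n l IH];
     rewrite ?big_nil // big_cons /= IH.
have mem n : n != 0 -> n \in behead pts by case: n => [[[] []] []].
have ft n : n \in behead pts -> nth false f (index n (behead pts)) = t n.
  move=> nl; have := nl; rewrite -index_mem => nl'.
  by rewrite nth_cat size_map nl' (nth_map 0) // nth_index.
have fs n : n \in behead pts -> nth false f (7 + index n (behead pts))%N = s n.
  move=> nl; have := nl; rewrite -index_mem => nl'.
  rewrite -[7%N]/(size (behead pts)) nth_cat size_map; case: ltnP => [|_].
    by rewrite ltnNge leq_addr.
  by rewrite addKn (nth_map 0) // nth_index.
have /all_bitsP/(_ f erefl) := hamming_ok; rewrite /hamming_check.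
case: ifP => [/negP[]|_].
  by apply/allP => n nl; rewrite ft // fs //; case: ifP => // /st.
case: ifP => [/negP[]|_].
  apply/allP => p pl; case: ifP => // /hasPn h; rewrite sumE.
  rewrite (eq_big_seq s); last by move=> n; rewrite mem_filter => /andP[_ /fs].
  apply: H => [|n np]; first by apply: contraTneq pl => ->.
  have nl : n \in behead pts by apply: mem; apply: contraTneq np => ->.
  by have := h n nl; rewrite np ft // negbK.
move=> /all_bitsP/existsNP[l /not_implyP[_ /negP]]; rewrite negbK => /allP h.
pose c x := nth false l (index x (behead pts)).
exists c => x y n0 tn; have := h _ (mem _ n0); rewrite ft ?mem // tn => /eqP.
rewrite fs ?mem // => <-; rewrite sumE -/c.
(* The points of a line are the nonzero vectors orthogonal to its normal. *)
have pe : perm_eq [:: x; y; x + y] [seq z <- behead pts | ~~ dot (cross x y) z].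
  by case: x y n0 {tn} => [[[] []] []] [[[] []] []]; vm_compute.
by rewrite -(perm_big _ pe) !big_cons big_nil /= addbF -addbA.
Qed.

Lemma span3_std p a b : [/\ span3 p a b P2 = a, span3 p a b P4 = b,
  span3 p a b P3 = a + p & span3 p a b P5 = b + p].
Proof. by rewrite /span3 /= ?addr0 ?add0r; split=> //; rewrite addrC. Qed.

Lemma xor4_span3 s p a b :
  xor4 (fun x y => s (span3 p a b x) (span3 p a b y)) P1 P2 P4 = xor4 s p a b.
Proof.
have [E2 E4 E3 E5] := span3_std p a b.
transitivity (s (span3 p a b P2) (span3 p a b P4) (+) s (span3 p a b P3) (span3 p a b P5)
    (+) s (span3 p a b P2) (span3 p a b P5) (+) s (span3 p a b P3) (span3 p a b P4)) => //.
by rewrite E2 E3 E4 E5.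
Qed.

Lemma coboundary_quad e s p a b : nice e -> nice (signed s e) -> line_fun s ->
  indep p a b -> xor4 s p a b ->
  e a b != 0 -> e (a + p) (b + p) != 0 -> e a (b + p) != 0 -> e (a + p) b != 0 ->
  coboundary_on e (fun x y => (-1) ^+ s x y).
Proof.
move=> ne ns [sC sD] pab X h1 h2 h3 h4; apply: (coboundary_span3 pab).
have [E2 E4 E3 E5] := span3_std p a b.
apply: (@coboundary_quad_std _ (fun x y => s (span3 p a b x) (span3 p a b y)));
  rewrite ?xor4_span3 ?E2 ?E4 ?E3 ?E5 //.
- exact: nice_span3.
- exact: (nice_span3 pab ns).
- by split=> x y; rewrite ?span3D.
Qed.

Definition touched e x y : bool := [|| e x y != 0, e x (x + y) != 0 | e y (x + y) != 0].

Lemma touched_line_fun e : nice e -> line_fun (touched e).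
Proof.
case=> eC _ _ _; split=> x y; rewrite /touched.
  by rewrite eC [y + x]addrC; congr (_ || _); rewrite orbC.
by rewrite addKx orbCA; congr [|| _, _ | _]; rewrite eC.
Qed.

(** By [quad_swap], the pair of the support found on the line {P2, P4, P6} dictates which pair
    occurs on each of the other three lines missing [P1]. The four pairs lie in the complement of a
    single line through [P1], so [coboundary_quad] applies, with one frame for each of the three
    possible pairs. *)
Lemma coboundary_bad_quad_std e s : nice e -> nice (signed s e) -> line_fun s ->
  xor4 s P1 P2 P4 -> touched e P2 P4 -> touched e P3 P5 -> touched e P2 P5 ->
  touched e P3 P4 -> coboundary_on e (fun x y => (-1) ^+ s x y).
Proof.
move=> ne ns ls X.
have Q x y := @quad_swap e s P1 P2 P4 x y ne ns ls isT X.
have eC : forall x y, e x y = e y x by case: ne.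
move=> /or3P[h|h|h] t35 t25 t34.
- have e35 : e P3 P5 != 0.
    case/or3P: t35 => // h'; first by case: (Q P2 P4 isT h); rewrite eC.
    by case: (Q P4 P2 isT); rewrite eC.
  have e25 : e P2 P5 != 0.
    case/or3P: t25 => // h'; first by case: (Q P2 P7 isT h'); rewrite eC.
    by case: (Q P5 P7 isT h').
  have e34 : e P3 P4 != 0.
    case/or3P: t34 => // h'; first by case: (Q P3 P7 isT h'); rewrite eC.
    by case: (Q P4 P7 isT h').
  exact: (coboundary_quad_std ne ns ls).
- have e37 : e P3 P7 != 0.
    case/or3P: t34 => // h'; first by case: (Q P2 P6 isT h); rewrite eC.
    by case: (Q P6 P2 isT); rewrite // eC.
  have e27 : e P2 P7 != 0.
    case/or3P: t25 => // h'; first by case: (Q P2 P5 isT h'); rewrite eC.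
    by case: (Q P7 P5 isT); rewrite // eC.
  have e36 : e P3 P6 != 0.
    case/or3P: t35 => // h'; first by case: (Q P3 P5 isT h'); rewrite eC.
    by case: (Q P6 P5 isT); rewrite // eC.
  apply: (@coboundary_quad e s P1 P2 P6) => //.
  by rewrite -(xor4_swap (p := P1) (a := P2) (b := P4)).
- have e57 : e P5 P7 != 0.
    case/or3P: t25 => // h'; first by case: (Q P4 P6 isT h h').
    by case: (Q P6 P4 isT); rewrite // eC.
  have e47 : e P4 P7 != 0.
    case/or3P: t34 => // h'; first by case: (Q P4 P3 isT); rewrite // eC.
    by case: (Q P7 P3 isT); rewrite // eC.
  have e56 : e P5 P6 != 0.
    case/or3P: t35 => // h'; first by case: (Q P5 P3 isT); rewrite // eC.
    by case: (Q P6 P3 isT); rewrite // eC.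
  apply: (@coboundary_quad e s P1 P4 P6) => //.
  by rewrite -(xor4_swap (p := P1) (a := P2) (b := P4)).
Qed.

Lemma quad_lines_dual p : p != 0 -> exists a b,
  indep p a b /\ perm_eq (quad_lines p a b) [seq n <- behead pts | dot n p].
Proof.
by case: p => [[[] []] []] // _;
  first [exists P2, P4; split; vm_compute; reflexivity
       | exists P1, P2; split; vm_compute; reflexivity
       | exists P1, P4; split; vm_compute; reflexivity].
Qed.

Lemma coboundary_sign e s : nice e -> nice (signed s e) -> line_fun s ->
  coboundary_on e (fun x y => (-1) ^+ s x y).
Proof.
move=> ne ns ls; have lt := touched_line_fun ne; have [eC e1 e0 _] := ne.
pose at_rep (f : pt -> pt -> bool) n := f (line_rep n).1 (line_rep n).2.
have at_repE f x y : line_fun f -> cross x y != 0 -> at_rep f (cross x y) = f x y.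
  by move=> lf n0; apply: line_fun_cross; rewrite ?line_repP.
(* Nothing is required on untouched lines, so u resets their sign to [false]. *)
pose t := at_rep (touched e); pose u n := t n && at_rep s n.
have [H|] := pselect (forall p, p != 0 -> (forall n, dot n p -> t n) ->
     ~~ \big[addb/false]_(n <- [seq n <- behead pts | dot n p]) u n).
  have [|c cE] := hamming _ H; first by move=> n /andP[].
  exists (fun x => (-1) ^+ c x); split=> [x|x y]; first by rewrite signr_eq0.
  have [->|exy] := eqVneq (e x y) 0; first by rewrite !mul0r.
  have n0 : cross x y != 0.
    rewrite cross_neq0; apply/and3P; split; apply: contraNneq exy => ->;
    by rewrite ?e0 // ?[e x 0]eC ?e0 ?e1.
  have tn : t (cross x y) by rewrite /t at_repE // /touched exy.
  have := cE x y n0 tn; rewrite /u tn at_repE //= => <-.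
  by rewrite !signr_addb; case: (c (x + y)); rewrite ?expr1 ?expr0 ?invrN1 ?invr1.
move=> /existsNP[p /not_implyP[p0 /not_implyP[tp /negP/negPn up]]].
have [a [b [pab pe]]] := quad_lines_dual p0.
have tq n : n \in quad_lines p a b -> t n.
  by rewrite (perm_mem pe) mem_filter => /andP[/tp].
have X : xor4 s p a b.
  rewrite xor4E //; move: up; rewrite -(perm_big _ pe) => up.
  apply: etrans up; apply: eq_big_seq => n /tq; rewrite /u => ->.
  by [].
have tE x y : touched e (span3 p a b x) (span3 p a b y) ->
    touched (fun x y => e (span3 p a b x) (span3 p a b y)) x y.
  by rewrite /touched !span3D.
have [E2 E4 E3 E5] := span3_std p a b.
have /and5P[n1 n2 n3 n4 _] := quad_lines_neq0 pab.
have tq' x y : cross x y != 0 -> cross x y \in quad_lines p a b -> touched e x y.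
  by move=> n0 /tq; rewrite /t at_repE.
apply: (coboundary_span3 pab).
apply: (@coboundary_bad_quad_std _ (fun x y => s (span3 p a b x) (span3 p a b y)));
  rewrite ?xor4_span3 //.
- exact: nice_span3.
- exact: (nice_span3 pab ns).
- by case: ls => sC sD; split=> x y; rewrite ?span3D.
all: by apply: tE; rewrite ?E2 ?E3 ?E4 ?E5; apply: tq'; rewrite // !inE eqxx ?orbT.
Qed.

End SignedCocycles.

(** * Coordinates on the homogeneous components *)

Definition deg (p : pt) : Z2_3 := (p.1.1%:R, p.1.2%:R, p.2%:R).

Lemma degD p q : deg (p + q) = deg p + deg q.
Proof. by apply/eqP; case: p q => [[[] []] []] [[[] []] []]. Qed.

Lemma deg_inj : injective deg.
Proof. by move=> [[[] []] []] [[[] []] []] /eqP. Qed.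

Lemma deg_surj g : exists p, deg p = g.
Proof.
have [f fK gK] : bijective deg.
  by apply: inj_card_bij deg_inj _; rewrite !card_prod !card_ord !card_bool.
by exists (f g).
Qed.

(** The index of the octonion unit of degree [deg p]: see [gdeg_idx]. *)
Definition idx (p : pt) : 'I_8 :=
  match p with
  | (false, false, false) => @Ordinal 8 0 isT
  | (true, false, false) => @Ordinal 8 1 isT
  | (false, true, false) => @Ordinal 8 2 isT
  | (false, false, true) => @Ordinal 8 3 isT
  | (true, true, true) => @Ordinal 8 4 isT
  | (true, true, false) => @Ordinal 8 5 isT
  | (true, false, true) => @Ordinal 8 6 isT
  | (false, true, true) => @Ordinal 8 7 isT
  end.

Arguments idx : simpl never.

Lemma gdeg_idx p : gdeg (idx p) = deg p.
Proof. by apply/eqP; case: p => [[[] []] []]. Qed.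

Lemma idx_inj : injective idx.
Proof. by move=> p q pq; apply: deg_inj; rewrite -!gdeg_idx pq. Qed.

Lemma idx0 : idx 0 = 0.
Proof. exact/val_inj. Qed.

Lemma idx_bij : bijective idx.
Proof. by apply: inj_card_bij idx_inj _; rewrite !card_prod !card_ord !card_bool. Qed.

Section Coordinates.
Variables (F : fieldType) (k : so_kind).
Implicit Types (x y z : so_alg F k) (g h p q : pt).

Definition od p : Oct F := oe F (idx p).
Definition homog g x : Prop := Lgrad F k (deg g) x.
(* For x of degree g, x e_p = cf g p x *: e_{g+p}: see homog_od. *)
Definition cf g p x : F := x (od p) 0 (idx (g + p)).

Lemma od_coord p q : od p 0 (idx q) = (p == q)%:R.
Proof. by rewrite mxE eqxx /= (inj_eq idx_inj) eq_sym. Qed.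

Lemma od_mem p : od p \in Ograd F (deg p).
Proof. by rewrite -gdeg_idx Ograd_gdeg memv_line. Qed.

Lemma mem_od p v : v \in Ograd F (deg p) -> v = v 0 (idx p) *: od p.
Proof.
by rewrite -gdeg_idx Ograd_gdeg => /vlineP[a ->]; rewrite !mxE !eqxx mulr1.
Qed.

Lemma homog_od g p x : homog g x -> x (od p) = cf g p x *: od (g + p).
Proof. by move=> /(_ _ _ (od_mem p)); rewrite -degD => /mem_od. Qed.

Lemma od_sum (v : Oct F) : v = \sum_p v 0 (idx p) *: od p.
Proof.
rewrite {1}[v]row_sum_delta (reindex idx) //.
by have [f fK gK] := idx_bij; exists f => ? _; rewrite ?fK ?gK.
Qed.

Lemma so_alg_eq0 g x : homog g x -> (forall p, cf g p x = 0) -> x = 0.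
Proof.
move=> xg x0; apply/val_inj/lfunP => v; rewrite [v]od_sum !linear_sum /=.
by apply: eq_bigr => p _; rewrite !linearZ /= zero_lfunE (homog_od _ xg) x0 scale0r.
Qed.

Lemma cf_linear g p a x y : cf g p (a *: x + y) = a * cf g p x + cf g p y.
Proof. by rewrite /cf /= add_lfunE scale_lfunE !mxE. Qed.

(** Skewness of x for the form, tested on e_p and e_{g+p}. *)
Lemma cfN_shift g p x : cf g (g + p) x = - cf g p x.
Proof.
have /in_soP [x4 _] := so_valP x.
have form u q : oct_form u (od q) = u 0 (idx q).
  rewrite /oct_form (bigD1 (idx q)) //= mxE !eqxx mulr1 big1 ?addr0 // => i iq.
  by rewrite mxE (negbTE iq) andbF mulr0.
have := x4 (od p) (od (g + p)); rewrite form oct_formC form.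
by move/eqP; rewrite addrC addr_eq0 /cf addKx => /eqP.
Qed.

Lemma cf_B3 g x : k = B3 -> cf g 0 x = 0.
Proof.
by have /in_soP [_ x3] := so_valP x => /x3; rewrite /cf /od idx0 => ->; rewrite mxE.
Qed.

Lemma homog_br g h x y : homog g x -> homog h y -> homog (g + h) (so_br x y).
Proof.
move=> xg yh i v vi; rewrite /= add_lfunE opp_lfunE !comp_lfunE degD.
rewrite rpredB //; first by rewrite -addrA; apply/xg/yh.
by rewrite [deg g + _]addrC -addrA; apply/yh/xg.
Qed.

Lemma cf_br g h p x y : homog g x -> homog h y ->
  cf (g + h) p (so_br x y) = cf g (h + p) x * cf h p y - cf h (g + p) y * cf g p x.
Proof.
move=> xg yh; rewrite {1}/cf /= add_lfunE opp_lfunE !comp_lfunE.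
rewrite (homog_od p yh) (homog_od p xg) [x (_ *: _)]linearZ [y (_ *: _)]linearZ /=
  (homog_od _ yh) (homog_od _ xg).
have E (a b : F) (v w : Oct F) i : (a *: v - b *: w) 0 i = a * v 0 i - b * w 0 i.
  by rewrite !mxE.
rewrite !scalerA E !od_coord !addrA [h + g]addrC !eqxx !mulr1.
by rewrite mulrC [X in _ - X]mulrC.
Qed.

(* In b3 the elementary skew endomorphisms involving e_0 are missing. *)
Definition allowed g p : bool :=
  if k is B3 then (p != 0) && (g + p != 0) else true.

(** The elementary skew endomorphism e_p -> e_{g+p}, e_{g+p} -> -e_p; the matrix acts on row vectors
    from the right. *)
Definition unit_end g p : gl F :=
  linfun (mulmxr (delta_mx (idx p) (idx (g + p)) - delta_mx (idx (g + p)) (idx p))).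

Lemma unit_endE g p q : unit_end g p (od q) =
  (p == q)%:R *: od (g + p) - (g + p == q)%:R *: od p.
Proof.
rewrite lfunE /= /od /oe mulmxBr !mul_delta_mx_cond !(inj_eq idx_inj).
by rewrite ![q == _]eq_sym !scaler_nat.
Qed.

(** The scalar replaces by 0 the endomorphisms involving e_0 in b3, so that [unit_so] is defined for
    all g and p. *)
Lemma unit_end_so g p : (allowed g p)%:R *: unit_end g p \in in_so k.
Proof.
have [gp|_] := boolP (allowed g p); last by rewrite scale0r rpred0.
rewrite scale1r; apply/in_soP; split=> [u v|kB].
  have formE (a c : Oct F) : oct_form a c = (a *m c^T) 0 0.
    by rewrite mxE; apply: eq_bigr => i _; rewrite !mxE.
  have MT (i j : 'I_8) : (delta_mx i j - delta_mx j i)^T =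
      - (delta_mx i j - delta_mx j i) :> 'M[F]_8.
    by rewrite linearB /= !trmx_delta opprB.
  rewrite !lfunE /= !formE trmx_mul MT mulNmx mulmxN mulmxA.
  by rewrite [X in _ + X]mxE subrr.
move: gp; rewrite /allowed kB => /andP[p0 gp0].
by rewrite -idx0 -/(od 0) unit_endE (negbTE p0) (negbTE gp0) !scale0r subrr.
Qed.

Definition unit_so g p : so_alg F k := SoAlg (unit_end_so g p).

Lemma cf_unit g p q : cf g q (unit_so g p) =
  (allowed g p)%:R * ((p == q)%:R - (g + p == q)%:R).
Proof.
rewrite /cf scale_lfunE unit_endE.
have E (a b c : F) (v w : Oct F) i :
    (c *: (a *: v - b *: w)) 0 i = c * (a * v 0 i - b * w 0 i).
  by rewrite !mxE.
rewrite E !od_coord (inj_eq (addrI g)).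
have -> : (p == g + q) = (g + p == q) by apply/eqP/eqP => [->|<-]; rewrite addKx.
by rewrite -!natrM !mulnb !andbb.
Qed.

Lemma unit_homog g p : homog g (unit_so g p).
Proof.
move=> i v; have [q <-] := deg_surj i => /mem_od ->.
rewrite linearZ /= rpredZ // scale_lfunE rpredZ // unit_endE -degD.
rewrite rpredB //; case: eqP => [<-|_]; rewrite ?scale0r ?rpred0 // scale1r.
  exact: od_mem.
by rewrite addKx od_mem.
Qed.

End Coordinates.

(** * Cocycle conditions satisfied by an admissible contraction *)

Section Contraction.
Variables (F : fieldType) (k : so_kind).
Implicit Types (x y z : so_alg F k) (g h p q : pt).

Lemma cf0 g p : cf g p (0 : so_alg F k) = 0.
Proof. by rewrite /cf /= zero_lfunE mxE. Qed.

Lemma cf_unit_id g p : g != 0 -> allowed k g p -> cf g p (unit_so F k g p) = 1.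
Proof.
move=> g0 gp; rewrite cf_unit gp eqxx -[X in _ == X]add0r (inj_eq (addIr p)).
by rewrite (negbTE g0) subr0 mulr1.
Qed.

Lemma cf_unit_out g p q : q != p -> q != g + p -> cf g q (unit_so F k g p) = 0.
Proof.
by move=> qp qgp; rewrite cf_unit ![_ == q]eq_sym (negbTE qp) (negbTE qgp) subrr mulr0.
Qed.

Lemma allowed_neq0 g p : p != 0 -> g + p != 0 -> allowed k g p.
Proof. by rewrite /allowed; case: k => // -> ->. Qed.

(** The two factors exchange, up to sign, e_h with e_{g+h} and e_{g+h} with e_g, so both avoid e_0
    and exist in b3 as well; the bracket has coefficient -1 on e_h. *)
Lemma so_br_neq0 g h : g != 0 -> h != 0 -> g != h ->
  so_br (unit_so F k g h) (unit_so F k h (g + h)) != 0.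
Proof.
move=> g0 h0 gh; have gh0 : g + h != 0 by rewrite addr_eq0; case: h {h0} gh => [[[] []] []].
apply/negP => /eqP b0; have := cf_br h (@unit_homog F k g h) (@unit_homog F k h (g + h)).
rewrite b0 addxx (cf_unit_out (q := 0)) 1?eq_sym // mul0r sub0r.
rewrite !cf_unit_id ?allowed_neq0 // ?mulr1; last by rewrite addrCA addxx addr0.
by rewrite cf0 => /eqP; rewrite eq_sym oppr_eq0 oner_eq0.
Qed.

Variable eps : Z2_3 -> Z2_3 -> F.
Hypothesis eps_contr : graded_contraction k eps.
Hypothesis eps_adm : admissible eps.
Let e g h := eps (deg g) (deg h).

Lemma deg0 : deg 0 = 0. Proof. by apply/eqP. Qed.

Lemma contr_br_deg g h x y : homog g x -> homog h y -> contr_br eps x y = e g h *: so_br x y.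
Proof. exact: contr_br_homog. Qed.

(** Polarization of the alternating law at x + y, for x and y whose bracket is nonzero. *)
Lemma contr_sym g h : e g h = e h g.
Proof.
have [a0 adm0 adm0'] : [/\ forall g, e g g = 0, forall g, e 0 g = 0 & forall g, e g 0 = 0].
  by split=> p; rewrite /e ?deg0; case: (eps_adm (deg p)).
have [->|g0] := eqVneq g 0; first by rewrite adm0 adm0'.
have [->|h0] := eqVneq h 0; first by rewrite adm0 adm0'.
have [->|gh] := eqVneq g h; first by [].
have [linl linr alt _] := eps_contr.
pose x := unit_so F k g h; pose y := unit_so F k h (g + h).
have [xg yh] : homog g x /\ homog h y by split; apply: unit_homog.
have add1 (a u v : so_alg F k) : contr_br eps (u + v) a = contr_br eps u a + contr_br eps v a.
  by have := linl a 1 u v; rewrite !scale1r.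
have add2 (a u v : so_alg F k) : contr_br eps a (u + v) = contr_br eps a u + contr_br eps a v.
  by have := linr a 1 u v; rewrite !scale1r.
have := alt (x + y); rewrite add1 !add2 !alt add0r addr0.
rewrite (contr_br_deg xg yh) (contr_br_deg yh xg).
have -> : so_br y x = - so_br x y by apply/val_inj; rewrite /= opprB.
rewrite scalerN -scalerBl => /eqP; rewrite scaler_eq0 (negbTE (so_br_neq0 g0 h0 gh)) orbF.
by rewrite subr_eq0 => /eqP.
Qed.

(** The elements x, y, z are the consecutive edges of the path e_h, e_{g+h}, e_g, e_{g+l}. The edges
    x and z are disjoint, so [z, x] = 0 and the Jacobi identity keeps two terms, which are compared
    on e_h. *)
Lemma contr_jacobi g h l : indep g h l -> e h l * e g (h + l) = e g h * e l (g + h).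
Proof.
move=> ghl.
pose P g h l := indep g h l ==> [&& g != 0, h != 0, l != 0, g + h != 0, g + l != 0,
  l != h, l != g + h & [&& g + h != g, g + h != l + g, h != g, h != l + g, 
   l + h != g & l + h != l + g]].
have : P g h l by move: g h l {ghl}; apply: all_pts3P; vm_compute.
rewrite /P ghl /= => /and5P[g0 h0 l0 gh0 /and4P[gl0 lh lgh]] /and5P[n1 n2 n3 n4 /andP[n5 n6]].
have [_ _ _ jac] := eps_contr.
pose x := unit_so F k g h; pose y := unit_so F k h (g + h); pose z := unit_so F k l g.
have [xg yh zl] : [/\ homog g x, homog h y & homog l z] by split; apply: unit_homog.
have hyz := homog_br yh zl; have hzx := homog_br zl xg; have hxy := homog_br xg yh.
have zx0 : so_br z x = 0.
  apply: (so_alg_eq0 hzx) => p; rewrite (cf_br _ zl xg).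
  have outE a b q : q \notin [:: b; a + b] -> cf a q (unit_so F k a b) = 0.
    by rewrite !inE negb_or => /andP[]; apply: cf_unit_out.
  have /andP[/orP H1 /orP H2] : ((p \notin [:: h; g + h]) || (g + p \notin [:: g; l + g]))
     && ((l + p \notin [:: h; g + h]) || (p \notin [:: g; l + g])).
    move: ghl; apply/implyP; move: p; apply/all_ptsP.
    move: g h l {g0 h0 l0 gh0 gl0 lh lgh n1 n2 n3 n4 n5 n6 x y z xg yh zl hyz hzx hxy}.
    by apply: all_pts3P; vm_compute.
  rewrite (_ : cf l (g + p) z * cf g p x = 0); last first.
    by case: H1 => /outE ->; rewrite ?mulr0 ?mul0r.
  by case: H2 => /outE ->; rewrite ?mulr0 ?mul0r subrr.
have := jac x y z; rewrite (contr_br_deg zl xg) zx0 scaler0.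
have br0 (a : so_alg F k) : contr_br eps a 0 = 0.
  by have [_ lin _ _] := eps_contr; have := lin a (-1) 0 0; rewrite !scaleN1r oppr0 addr0 addNr.
rewrite br0 addr0 (contr_br_deg yh zl) (contr_br_deg xg yh).
have brZ (a w : so_alg F k) c : contr_br eps a (c *: w) = c *: contr_br eps a w.
  by have [_ lin _ _] := eps_contr; have := lin a c w 0; rewrite br0 !addr0.
rewrite !brZ (contr_br_deg xg hyz) (contr_br_deg zl hxy) !scalerA.
move=> /(congr1 (cf (g + (h + l)) h)).
have cfD n q c c' (u v : so_alg F k) : cf n q (c *: u + c' *: v) = c * cf n q u + c' * cf n q v.
  by rewrite -[c' *: v]addr0 !cf_linear cf0 addr0.
rewrite cfD (cf_br _ xg hyz).
have -> : g + (h + l) = l + (g + h) by rewrite addrA addrC.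
rewrite (cf_br _ zl hxy) (cf_br _ yh zl) (cf_br _ xg yh).
rewrite cf0.
rewrite (cf_br _ yh zl) [h + l + h]addrC addKx -[g + h + h]addrA addxx addr0.
rewrite [h + (g + h)]addrCA addxx addr0.
have -> : cf g l x = 0 by apply: cf_unit_out.
have -> : cf g 0 x = 0 by apply: cf_unit_out; rewrite eq_sym.
have -> : cf l h z = 0 by apply: cf_unit_out.
have -> : cf l (g + h) z = 0 by apply: cf_unit_out.
have -> : cf g h x = 1 by apply: cf_unit_id => //; apply: allowed_neq0.
have -> : cf h (g + h) y = 1.
  by apply: cf_unit_id => //; apply: allowed_neq0; rewrite // addrCA addxx addr0.
have -> : cf l g z = 1 by apply: cf_unit_id => //; apply: allowed_neq0; rewrite // addrC.
rewrite !(mulr0, mul0r, mulr1, sub0r, subr0, opprK, mulrN1) => /eqP.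
by rewrite subr_eq0 => /eqP.
Qed.

Lemma contr_nice : [/\ forall g h, e g h = e h g, forall g, e g g = 0, forall g, e 0 g = 0
  & forall g h l, indep g h l -> e h l * e g (h + l) = e g h * e l (g + h)].
Proof.
split; first exact: contr_sym; last exact: contr_jacobi.
all: by move=> g; rewrite /e ?deg0; case: (eps_adm (deg g)).
Qed.
End Contraction.

(** * Brackets along a line *)

Section Frame.
Variables (F : fieldType) (k : so_kind).
Implicit Types (x y z : so_alg F k) (g h o p q t : pt) (s : bool) (i j : bool * bool).
Hypothesis two_neq0 : 2%:R != 0 :> F.

(* For the line {g, o, g + o} and t outside it, i = (b, s) consists of a
   coset of {0, g, o, g + o}, that of t or of 0, and a sign; by xi_br the bracket
   is diagonal in these coordinates. In b3 the two signs give the same coordinate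
   up to sign on the coset of 0, and only one of them is valid. *)
Definition xi g o t i x : F :=
  let p := if i.1 then t else 0 in cf g p x + (-1) ^+ i.2 * cf g (o + p) x.

Definition valid i : bool := if k is B3 then i.1 || ~~ i.2 else true.

(** The basis dual to the coordinates [xi], up to the factors [weight]: see [xi_frame]. *)
Definition frame g o t i : so_alg F k :=
  let p := if i.1 then t else 0 in
  unit_so F k g p + (-1) ^+ i.2 *: unit_so F k g (o + p).

Lemma xi_linear g o t i a x y : xi g o t i (a *: x + y) = a * xi g o t i x + xi g o t i y.
Proof. by rewrite /xi !cf_linear; ring. Qed.

Lemma homogD g a x y : homog g x -> homog g y -> homog g (a *: x + y).
Proof.
by move=> xg yg i v vi; rewrite /= add_lfunE scale_lfunE rpredD ?rpredZ //; [apply: xg|apply: yg].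
Qed.

Lemma frame_homog g o t i : homog g (frame g o t i).
Proof. by rewrite /frame addrC; apply: homogD; apply: unit_homog. Qed.

(** The product on the right expands into four terms; up to sign they are the terms of the two
    commutator coefficients on the left, once [cfN_shift] has moved arguments by g, h or g + h. *)
Lemma xi_br g h t i x y : homog g x -> homog h y ->
  xi (g + h) g t i (so_br x y) = (-1) ^+ i.2 * xi g h t i x * xi h (g + h) t i y.
Proof.
move=> xg yh; rewrite /xi; move: (if i.1 then t else 0) => p; move: i.2 => s.
have Ex : cf g (h + (g + p)) x = - cf g (h + p) x by rewrite addrCA cfN_shift.
have Ey : cf h (g + (h + p)) y = - cf h (g + p) y by rewrite addrCA cfN_shift.
rewrite !(cf_br _ xg yh) addKx -(addrA g h p) Ex Ey cfN_shift.
by case: s; rewrite /= ?expr1 ?expr0; ring.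
Qed.

(** Four representatives modulo g suffice, since [cfN_shift] relates the coefficients at r and g +
    r. *)
Lemma indep_span g o t q : indep g o t ->
  exists2 r, r \in [:: 0; o; t; o + t] & (q = r) \/ (q = g + r).
Proof.
move=> got; have : has (fun r => (q == r) || (q == g + r)) [:: 0; o; t; o + t].
  by move: got; apply/implyP; move: q; apply/all_ptsP; move: g o t;
     apply: all_pts3P; vm_compute.
by case/hasP => r rl /orP[] /eqP ->; exists r; rewrite // ?eqxx; [left|right].
Qed.

Definition quad o t (a b : bool) : pt :=
  let p := if a then t else 0 in if b then o + p else p.

Lemma quad_eq g o t a b a' b' : indep g o t ->
  ((quad o t a b == quad o t a' b') = (a == a') && (b == b')) *
  ((g + quad o t a b == quad o t a' b') = false) *
  ((quad o t a b == 0) = ~~ a && ~~ b) * ((g + quad o t a b == 0) = false).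
Proof.
pose P g o t := indep g o t ==> [&& (quad o t a b == quad o t a' b') == ((a == a') && (b == b')),
  (g + quad o t a b == quad o t a' b') == false,
  (quad o t a b == 0) == (~~ a && ~~ b) & (g + quad o t a b == 0) == false].
have : P g o t.
  by move: g o t; apply: all_pts3P; case: a b a' b' @P => [] [] [] []; vm_compute.
by rewrite /P => /implyP P' /P' /and4P[/eqP-> /eqP-> /eqP-> /eqP->].
Qed.

Lemma allowed_quad g o t a b : indep g o t ->
  allowed k g (quad o t a b) = (if k is B3 then a || b else true).
Proof.
by move=> got; rewrite /allowed !(quad_eq _ _ a b got) andbT -negb_or negbK.
Qed.

Lemma cf_unit_quad g o t a b a' b' : indep g o t ->
  cf g (quad o t a b) (unit_so F k g (quad o t a' b')) =
  ((if k is B3 then a || b else true) && (a == a') && (b == b'))%:R.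
Proof.
move=> got; rewrite cf_unit !(quad_eq _ _ _ _ got) (allowed_quad _ _ got) subr0 -natrM mulnb.
by rewrite -andbA; case: k => //; case: a b a' b' => [] [] [] [].
Qed.

(** The weight is 1 in b3 on the coset of 0 because [unit_so F k g 0] vanishes there, leaving a
    single term in the frame vector. *)
Definition weight i : F := if k is B3 then (if i.1 then 2%:R else 1) else 2%:R.

Lemma weight_neq0 i : weight i != 0.
Proof. by rewrite /weight; case: k; case: i.1; rewrite ?oner_eq0. Qed.

Lemma xiE g o t i x :
  xi g o t i x = cf g (quad o t i.1 false) x + (-1) ^+ i.2 * cf g (quad o t i.1 true) x.
Proof. by []. Qed.

Lemma xi_frame g o t i j : indep g o t -> valid i -> valid j ->
  xi g o t i (frame g o t j) = (i == j)%:R * weight i.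
Proof.
move=> got; rewrite xiE /frame -[if j.1 then t else 0]/(quad o t j.1 false).
rewrite -[o + _]/(quad o t j.1 true) !(addrC (unit_so _ _ _ _)) !cf_linear !cf_unit_quad //.
rewrite /valid /weight; case: i j => [[] []] [[] []]; case: k => //= _ _;
  rewrite ?expr0 ?expr1; ring.
Qed.

Lemma addB_eq0 (a b : F) : a + b = 0 -> a - b = 0 -> a = 0 /\ b = 0.
Proof.
move=> ab; move/eqP; rewrite subr_eq0 => /eqP E; move: ab; rewrite E -mulr2n -mulr_natr.
by move/eqP; rewrite mulf_eq0 (negbTE two_neq0) orbF => /eqP.
Qed.

(** The two signs on a coset give the sum and the difference of two coefficients, and 2 is
    invertible. For b3 on the coset of 0, one sign is enough because [cf g 0 x = 0]. *)
Lemma xi_eq0 g o t x : indep g o t -> homog g x ->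
  (forall i, valid i -> xi g o t i x = 0) -> x = 0.
Proof.
move=> got xg x0.
have half := addB_eq0.
have v1 s : valid (true, s) by rewrite /valid; case: k.
have v0 : valid (false, false) by rewrite /valid; case: k.
have v2 : k = B3 \/ valid (false, true) by rewrite /valid; case: k; [right|left].
have cf_quad b : cf g (quad o t true b) x = 0.
  have [||E1 E2] := half (cf g (quad o t true false) x) (cf g (quad o t true true) x).
  - by have := x0 _ (v1 false); rewrite xiE expr0 mul1r.
  - by have := x0 _ (v1 true); rewrite xiE expr1 mulN1r.
  by case: b.
have cf_quad0 b : cf g (quad o t false b) x = 0.
  have := x0 _ v0; rewrite xiE /= expr0 mul1r; case: v2 => [kB|v2].
    by have h := cf_B3 g x kB; rewrite h add0r; case: b.
  have := x0 _ v2; rewrite xiE /= expr1 mulN1r => h1 h2.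
  by have [E1 E2] := half _ _ h2 h1; case: b.
apply: (so_alg_eq0 xg) => p.
have [r + rE] := indep_span p got.
have r0 : r \in [:: 0; o; t; o + t] -> cf g r x = 0.
  rewrite !inE => /or4P[] /eqP ->.
  - exact: (cf_quad0 false).
  - by have := cf_quad0 true; rewrite /quad addr0.
  - exact: (cf_quad false).
  - exact: (cf_quad true).
by case: rE => -> /r0; rewrite ?cfN_shift => ->; rewrite ?oppr0.
Qed.

End Frame.

(** * Graded isomorphisms in the coordinates of a line *)

Section Isomorphism.
Variables (F : fieldType) (k : so_kind).
Hypothesis two_neq0 : 2%:R != 0 :> F.
Notation so := (so_alg F k).
Variable f : {linear so -> so}.
Hypothesis f_homog : forall g x, homog g x -> homog g (f x).
Hypothesis f_onto : forall g y, homog g y -> exists2 x, homog g x & f x = y.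
Implicit Types (x y z : so) (g h o p q t : pt) (i j : bool * bool).

Lemma xi_sum g o t i (I : finType) (P : pred I) (x : I -> so) :
  xi g o t i (\sum_(n | P n) x n) = \sum_(n | P n) xi g o t i (x n).
Proof.
have xi0 : xi g o t i (0 : so) = 0 by rewrite /xi !cf0 mulr0 addr0.
apply: big_morph => // u v; by rewrite -[u]scale1r xi_linear mul1r scale1r.
Qed.

Lemma xiZ g o t i a x : xi g o t i (a *: x) = a * xi g o t i x.
Proof. by rewrite -[a *: x]addr0 xi_linear /xi !cf0 mulr0 !addr0. Qed.

Lemma homog_sum g (I : finType) (P : pred I) (x : I -> so) :
  (forall n, P n -> homog g (x n)) -> homog g (\sum_(n | P n) x n).
Proof.
move=> xg; apply: big_ind => // [|u v ug vg].
  by move=> i v _; rewrite /= zero_lfunE rpred0.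
by rewrite -[u]scale1r; apply: homogD.
Qed.

Lemma frame_expand g o t x : indep g o t -> homog g x ->
  x = \sum_(i | valid k i) (xi g o t i x / weight F k i) *: frame F k g o t i.
Proof.
move=> got xg; apply/eqP; rewrite -subr_eq0; apply/eqP.
apply: (xi_eq0 two_neq0 got) => [|j vj].
  rewrite -[x]scale1r -scaleN1r addrC; apply: homogD; last by rewrite scale1r.
  apply: homog_sum => i _; rewrite -[_ *: _]addr0; apply: homogD; first exact: frame_homog.
  by move=> n v _; rewrite /= zero_lfunE rpred0.
rewrite -scaleN1r addrC xi_linear xi_sum (bigD1 j) //= big1 => [|i /andP[vi ij]].
  by rewrite addr0 xiZ xi_frame // eqxx mul1r divfK ?weight_neq0 // mulN1r addNr.
by rewrite xiZ xi_frame // eq_sym (negbTE ij) mul0r mulr0.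
Qed.

Lemma xi_f_single g o t o' t' i j : indep g o t -> valid k j ->
  (forall n, valid k n -> n != j -> xi g o' t' i (f (frame F k g o t n)) = 0) ->
  forall x, homog g x ->
  xi g o' t' i (f x) = xi g o' t' i (f (frame F k g o t j)) / weight F k j * xi g o t j x.
Proof.
move=> got vj zj x xg; rewrite {1}(frame_expand got xg) linear_sum xi_sum.
rewrite (bigD1 j) //= big1 ?addr0 => [|n /andP[vn nj]].
  by rewrite linearZ /= xiZ mulrC mulrA mulrAC.
by rewrite linearZ /= xiZ zj ?mulr0.
Qed.

(** Otherwise coordinate i would vanish on the image of f, which contains the i-th frame vector. *)
Lemma xi_f_exists g o t i : indep g o t -> valid k i ->
  exists2 j, valid k j & xi g o t i (f (frame F k g o t j)) != 0.
Proof.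
move=> got vi; apply: contrapT => nj.
have [x xg fx] := f_onto (@frame_homog F k g o t i).
have := xi_frame F got vi vi; rewrite -fx {1}(frame_expand got xg) linear_sum xi_sum big1.
  by rewrite eqxx mul1r => /esym/eqP; rewrite (negbTE (weight_neq0 _ _ _)).
move=> j vj; rewrite linearZ /= xiZ.
have [->|n0] := eqVneq (xi g o t i (f (frame F k g o t j))) 0; first by rewrite mulr0.
by case: nj; exists j.
Qed.

(* The transpose of f maps the coordinate i to a nonzero multiple of j. *)
Definition carries g o t i j (a : F) : Prop :=
  [/\ valid k i, valid k j, a != 0
    & forall x, homog g x -> xi g o t i (f x) = a * xi g o t j x].

Lemma carries_inj g o t i i' j a a' : indep g o t ->
  carries g o t i j a -> carries g o t i' j a' -> i = i'.
Proof.
move=> got [vi vj a0 fi] [vi' _ a'0 fi']; apply/eqP/negPn/negP => ii'.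
have [x xg fx] := f_onto (@frame_homog F k g o t i).
have := fi x xg; have := fi' x xg; rewrite fx !xi_frame // eqxx mul1r eq_sym (negbTE ii') mul0r.
move=> /esym/eqP; rewrite mulf_eq0 (negbTE a'0) /= => /eqP ->; rewrite mulr0 => /eqP.
by rewrite (negbTE (weight_neq0 _ _ _)).
Qed.

(** Brackets of frame vectors with different indices vanish, so coordinate i of f X_n times
    coordinate i of f Y_m is 0 for n != m. Neither factor vanishes for all indices, hence each is
    nonzero at exactly one index, the same for both. The third point follows because Z_n is a
    multiple of [X_n, Y_n]. *)
Lemma line_carries g h t (c c' : F) : indep g h t -> c != 0 -> c' != 0 ->
  (forall x y, homog g x -> homog h y -> c *: f (so_br x y) = c' *: so_br (f x) (f y)) ->
  forall i, valid k i -> exists j a1 a2 a3,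
    [/\ carries g h t i j a1, carries h (g + h) t i j a2 & carries (g + h) g t i j a3].
Proof.
move=> ght c0 c'0 fbr i vi.
have [hgt kgt] : indep h (g + h) t /\ indep (g + h) g t.
  by split; move: ght; apply/implyP; move: g h t {fbr}; apply: all_pts3P; vm_compute.
have s0 n : (-1) ^+ n != 0 :> F by rewrite signr_eq0.
pose X := frame F k g h t; pose Y := frame F k h (g + h) t; pose Z := frame F k (g + h) g t.
have XY n m : valid k n -> valid k m -> n != m -> so_br (X n) (Y m) = 0.
  move=> vn vm nm.
  apply: (xi_eq0 two_neq0 kgt) => [|l vl]; first by apply: homog_br; apply: frame_homog.
  rewrite xi_br; [|exact: frame_homog|exact: frame_homog].
  rewrite !xi_frame //; case: (eqVneq l n) => [->|_]; last by rewrite mul0r mulr0 mul0r.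
  by rewrite (negbTE nm) mul0r mulr0.
have ZXY n : valid k n -> exists2 b, b != 0 & Z n = b *: so_br (X n) (Y n).
  move=> vn; pose b : F := (-1) ^+ n.2 / weight F k n.
  have Bh : homog (g + h) (so_br (X n) (Y n)) by apply: homog_br; apply: frame_homog.
  exists b; first by rewrite mulf_neq0 ?invr_eq0 ?weight_neq0.
  suff E : - b *: so_br (X n) (Y n) + Z n = 0.
    by move/eqP: E; rewrite scaleNr addrC subr_eq0 => /eqP.
  apply: (xi_eq0 two_neq0 kgt) => [|l vl].
    by apply: homogD; [exact: Bh|exact: frame_homog].
  rewrite xi_linear xi_br; [|exact: frame_homog|exact: frame_homog].
  rewrite !xi_frame //; case: (eqVneq l n) => [->|_]; last by rewrite !(mul0r, mulr0, addr0).
  rewrite !mul1r /b; have := weight_neq0 k two_neq0 n; move: (weight F k n) => w w0.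
  have := sqrr_sign F n.2; move: ((-1) ^+ n.2) => e ee.
  rewrite (_ : - (e / w) * (e * w * w) = - e ^+ 2 * w); last by field.
  by rewrite ee mulN1r addNr.
have br_f n m : valid k n -> valid k m -> 
    c * xi (g + h) g t i (f (so_br (X n) (Y m))) =
    c' * ((-1) ^+ i.2 * xi g h t i (f (X n)) * xi h (g + h) t i (f (Y m))).
  move=> vn vm; rewrite -xiZ fbr ?xiZ ?xi_br //;
    by [apply: f_homog; apply: frame_homog|apply: frame_homog].
have cross0 n m : valid k n -> valid k m -> n != m ->
    xi g h t i (f (X n)) * xi h (g + h) t i (f (Y m)) = 0.
  move=> vn vm nm; have := br_f n m vn vm; rewrite XY // linear0.
  have -> : xi (g + h) g t i (0 : so) = 0 by rewrite /xi !cf0 mulr0 addr0.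
  rewrite mulr0 -mulrA => /esym/eqP; rewrite !mulf_eq0 (negbTE c'0) (negbTE (s0 _)) /=.
  by case/orP => /eqP ->; rewrite ?mul0r ?mulr0.
(* A nonzero entry in each family; [cross0] forces the two indices to agree and all other entries to
   vanish. *)
have [j vj xj] := xi_f_exists ght vi; have [m vm ym] := xi_f_exists hgt vi.
have Y0 n : valid k n -> n != j -> xi h (g + h) t i (f (Y n)) = 0.
  move=> vn nj; have := cross0 j n vj vn; rewrite eq_sym => /(_ nj)/eqP.
  by rewrite mulf_eq0 (negbTE xj) => /eqP.
have mj : m = j by apply: contra_neq_eq ym => /Y0; apply.
rewrite {}mj in vm ym.
have X0 n : valid k n -> n != j -> xi g h t i (f (X n)) = 0.
  move=> vn nj; have := cross0 n j vn vj nj => /eqP.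
  by rewrite mulf_eq0 (negbTE ym) orbF => /eqP.
have ZX n : valid k n -> exists2 b, b != 0 &
    xi (g + h) g t i (f (Z n)) = b * (xi g h t i (f (X n)) * xi h (g + h) t i (f (Y n))).
  move=> vn; have [b b0 ->] := ZXY n vn; rewrite linearZ /= xiZ.
  exists (b * (c^-1 * c' * (-1) ^+ i.2)); first by rewrite !mulf_neq0 ?invr_eq0.
  apply: (mulfI c0); rewrite mulrCA br_f //.
  by move: (xi _ _ _ _ _) (xi _ _ _ _ _) ((-1) ^+ i.2) => u v w; field.
have Z0 n : valid k n -> n != j -> xi (g + h) g t i (f (Z n)) = 0.
  by move=> vn nj; have [b _ ->] := ZX n vn; rewrite X0 // mul0r mulr0.
have zj : xi (g + h) g t i (f (Z j)) != 0.
  by have [b b0 ->] := ZX j vj; rewrite !mulf_neq0.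
have w0 := weight_neq0 k two_neq0 j.
exists j, (xi g h t i (f (X j)) / weight F k j), (xi h (g + h) t i (f (Y j)) / weight F k j),
  (xi (g + h) g t i (f (Z j)) / weight F k j).
by split; split; rewrite ?mulf_neq0 ?invr_eq0 //; apply: xi_f_single.
Qed.
End Isomorphism.

(** * Two lines through a point *)

Section Gram.
Variables (F : fieldType) (k : so_kind).
Hypothesis two_neq0 : 2%:R != 0 :> F.
Notation so := (so_alg F k).
Variable f : {linear so -> so}.
Hypothesis f_homog : forall g x, homog g x -> homog g (f x).
Hypothesis f_onto : forall g y, homog g y -> exists2 x, homog g x & f x = y.
Implicit Types (x y z : so) (g h o p q t u : pt) (i j : bool * bool).

(** Coordinate i of the hypothesis on the j-th frame vectors; [xi_br] contributes the sign of j
    before applying f and the sign of i after. *)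
Lemma carries_edge g h t i j (c c' a1 a2 a3 : F) : indep g h t ->
  (forall x y, homog g x -> homog h y -> c *: f (so_br x y) = c' *: so_br (f x) (f y)) ->
  carries f g h t i j a1 -> carries f h (g + h) t i j a2 -> carries f (g + h) g t i j a3 ->
  c * a3 * (-1) ^+ j.2 = c' * (-1) ^+ i.2 * (a1 * a2).
Proof.
move=> ght fbr [vi vj _ f1] [_ _ _ f2] [_ _ _ f3].
have hgt : indep h (g + h) t.
  by move: ght; apply/implyP; move: g h t {fbr f1 f2 f3}; apply: all_pts3P; vm_compute.
pose x := frame F k g h t j; pose y := frame F k h (g + h) t j.
have [xg yh] : homog g x /\ homog h y by split; apply: frame_homog.
have := congr1 (xi (g + h) g t i) (fbr x y xg yh).
have xyh := homog_br xg yh.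
rewrite !xiZ f3 // !xi_br ?f1 ?f2 //; try exact: f_homog.
rewrite !xi_frame // eqxx mul1r => E.
have w0 := weight_neq0 k two_neq0 j.
apply: (mulIf w0); apply: (mulIf w0); move: E; rewrite !mulrA => E.
by rewrite E; move: (weight _ _ _) ((-1) ^+ i.2) => w s; ring.
Qed.

(* Gram matrix of the rows of f on L_g. *)
Definition gram g q q' : F :=
  \sum_u cf g q (f (unit_so F k g u)) * cf g q' (f (unit_so F k g u)).

Lemma gramC g q q' : gram g q q' = gram g q' q.
Proof. by apply: eq_bigr => u _; rewrite mulrC. Qed.

Lemma gramN g q q' : gram g (g + q) q' = - gram g q q'.
Proof. by rewrite /gram -sumrN; apply: eq_bigr => u _; rewrite cfN_shift mulNr. Qed.

Lemma gram_B3 g q : k = B3 -> gram g 0 q = 0.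
Proof. by move=> kB; apply: big1 => u _; rewrite cf_B3 // mul0r. Qed.

Lemma allowedD g q : allowed k g (g + q) = allowed k g q.
Proof. by rewrite /allowed addKx; case: k; rewrite // andbC. Qed.

Lemma sum_cf_unit g q q' : g != 0 ->
  \sum_u cf g q (unit_so F k g u) * cf g q' (unit_so F k g u) =
  2%:R * cf g q' (unit_so F k g q).
Proof.
move=> g0; rewrite (bigD1 q) // (bigD1 (g + q)) /=; last first.
  by rewrite -subr_eq0 addrK.
rewrite big1 ?addr0 => [|u /andP[uq ugq]]; last first.
  rewrite cf_unit_out ?mul0r // 1?eq_sym //; apply: contraNneq ugq => <-.
  by rewrite addKx.
have nq : (g + q == q) = false by rewrite -[X in _ == X]add0r (inj_eq (addIr q)) (negbTE g0).
rewrite !cf_unit allowedD addKx !eqxx nq.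
by case: (allowed k g q); rewrite /=; ring.
Qed.

Lemma sum_xi_unit g o t i j : indep g o t -> valid k i -> valid k j ->
  \sum_u xi g o t i (unit_so F k g u) * xi g o t j (unit_so F k g u) =
  (i == j)%:R * (2%:R * weight F k i).
Proof.
move=> got vi vj; have /and4P[g0 _ _ _] := got.
pose S q q' := \sum_u cf g q (unit_so F k g u) * cf g q' (unit_so F k g u).
transitivity (S (quad o t i.1 false) (quad o t j.1 false)
  + (-1) ^+ j.2 * S (quad o t i.1 false) (quad o t j.1 true)
  + (-1) ^+ i.2 * S (quad o t i.1 true) (quad o t j.1 false)
  + (-1) ^+ i.2 * (-1) ^+ j.2 * S (quad o t i.1 true) (quad o t j.1 true)).
  rewrite /S !mulr_sumr -!big_split /=; apply: eq_bigr => u _; rewrite !xiE; ring.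
transitivity (2%:R * xi g o t j (frame F k g o t i)); last first.
  by rewrite xi_frame // eq_sym; case: (eqVneq i j) => [->|_]; rewrite /=; ring.
rewrite /S !sum_cf_unit // xiE /frame -[if i.1 then t else 0]/(quad o t i.1 false).
rewrite -[o + _]/(quad o t i.1 true).
by rewrite !(addrC (unit_so _ _ _ _)) !cf_linear; ring.
Qed.

(** The left side is the inner product of the rows i and i' of f in the coordinates [xi]. These rows
    are a and a' times the coordinate rows j and j', which are orthogonal by [sum_xi_unit]. *)
Lemma gram_xi g o t i i' j j' a a' : indep g o t ->
  carries f g o t i j a -> carries f g o t i' j' a' ->
  gram g (quad o t i.1 false) (quad o t i'.1 false)
  + (-1) ^+ i'.2 * gram g (quad o t i.1 false) (quad o t i'.1 true)
  + (-1) ^+ i.2 * gram g (quad o t i.1 true) (quad o t i'.1 false)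
  + (-1) ^+ i.2 * (-1) ^+ i'.2 * gram g (quad o t i.1 true) (quad o t i'.1 true)
  = a * a' * ((j == j')%:R * (2%:R * weight F k j)).
Proof.
move=> got [vi vj _ fi] [vi' vj' _ fi'].
rewrite -(sum_xi_unit got vj vj') mulr_sumr /gram !mulr_sumr -!big_split /=.
apply: eq_bigr => u _; have ug := @unit_homog F k g u.
by rewrite [RHS]mulrACA -fi // -fi' // !xiE; ring.
Qed.

Definition monomial_on g o t : Prop :=
  forall i, valid k i -> exists j a, carries f g o t i j a.

(** Distinct rows i and i' are carried to distinct j and j' by [carries_inj], so they are
    orthogonal. Separating the signs gives zero between the two cosets and equal diagonal entries
    within a coset. *)
Lemma gram_line g o t : indep g o t -> monomial_on g o t ->
  [/\ forall b b', gram g (quad o t false b) (quad o t true b') = 0,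
      gram g t t = gram g (o + t) (o + t)
    & k = D4 -> gram g 0 0 = gram g o o].
Proof.
move=> got mono.
have orth i i' : valid k i -> valid k i' -> i != i' ->
    gram g (quad o t i.1 false) (quad o t i'.1 false)
  + (-1) ^+ i'.2 * gram g (quad o t i.1 false) (quad o t i'.1 true)
  + (-1) ^+ i.2 * gram g (quad o t i.1 true) (quad o t i'.1 false)
  + (-1) ^+ i.2 * (-1) ^+ i'.2 * gram g (quad o t i.1 true) (quad o t i'.1 true) = 0.
  move=> vi vi' ii'; have [j [a R]] := mono _ vi; have [j' [a' R']] := mono _ vi'.
  rewrite (gram_xi got R R'); case: eqP => [jj|_]; last by rewrite mul0r mulr0.
  by move: R'; rewrite -jj => /(carries_inj two_neq0 f_onto got R) ii; rewrite ii eqxx in ii'.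
have half := addB_eq0 two_neq0.
have v1 s : valid k (true, s) by rewrite /valid; case: k.
have v0 : valid k (false, false) by rewrite /valid; case: k.
have v2 : k = D4 -> valid k (false, true) by move->.
have quad0 : quad o t false true = o by rewrite /quad addr0.
have half2 (a b c d : F) : a + b + c + d = 0 -> a - b + c - d = 0 -> a + c = 0 /\ b + d = 0.
  by move=> h1 h2; apply: half; [rewrite -[RHS]h1|rewrite -[RHS]h2]; ring.
split.
- have := orth _ _ v0 (v1 false) isT; have := orth _ _ v0 (v1 true) isT => /=.
  rewrite !(expr0, expr1, mul1r, mulN1r) => E1 E2.
  have [E3 E4] := half2 _ _ _ _ E2 E1.
  have [E5 E6] : gram g (quad o t false false) (quad o t true false) = 0 /\
      gram g (quad o t false false) (quad o t true true) = 0.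
    have [kB|kD] : k = B3 \/ k = D4 by case: k; [right|left].
      by split; apply: gram_B3.
    have := orth _ _ (v2 kD) (v1 false) isT; have := orth _ _ (v2 kD) (v1 true) isT => /=.
    rewrite !(expr0, expr1, mul1r, mulN1r, mulrNN, mulrN1) => E5 E6.
    have [||E7 E8] := half2 (gram g (quad o t false false) (quad o t true false))
       (gram g (quad o t false false) (quad o t true true))
       (- gram g (quad o t false true) (quad o t true false))
       (- gram g (quad o t false true) (quad o t true true)).
    - by rewrite -[RHS]E6; ring.
    - by rewrite -[RHS]E5; ring.
    by split; [case: (half _ _ E3 E7)|case: (half _ _ E4 E8)].
  by move: E3 E4; rewrite E5 E6 !add0r => E3 E4 [] [].
- have := orth _ _ (v1 false) (v1 true) isT => /=.
  rewrite !(expr0, expr1, mul1r, mulN1r) gramC => /eqP.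
  by rewrite subrK subr_eq0 => /eqP.
move=> kD; have := orth _ _ v0 (v2 kD) isT => /=.
rewrite !(expr0, expr1, mul1r, mulN1r) addr0 [gram g 0 o]gramC => /eqP.
by rewrite subrK subr_eq0 => /eqP.
Qed.

(** The partitions {0, o}, {t, o + t} and {0, t}, {o, o + t} together separate any two of the four
    representatives, so all off-diagonal entries vanish; their equalities link all allowed diagonal
    entries. Hence f is a similitude on L_g. *)
Lemma gram_two_lines g o t : indep g o t -> monomial_on g o t -> monomial_on g t o ->
  exists kap, (forall q, allowed k g q -> gram g q q = kap) /\
    (forall q q', q' != q -> q' != g + q -> gram g q q' = 0).
Proof.
move=> got mono mono'.
have gto : indep g t o.
  by move: got; apply/implyP; move: g o t {mono mono'}; apply: all_pts3P; vm_compute.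
have [Z1 D1 DD1] := gram_line got mono; have [Z2 D2 DD2] := gram_line gto mono'.
have := Z1 false false; have := Z1 false true; have := Z1 true false; have := Z1 true true.
have := Z2 false false; have := Z2 true false.
rewrite /quad !addr0 => G_t_o G_0_o G_o_ot G_o_t G_0_ot G_0_t.
have G_t_ot : gram g t (o + t) = 0.
  by rewrite [o + t]addrC; have := Z2 true true; rewrite /quad addr0.
exists (gram g (o + t) (o + t)).
have diag r : r \in [:: 0; o; t; o + t] -> allowed k g r -> gram g r r = gram g (o + t) (o + t).
  rewrite !inE => /or4P[] /eqP -> //; last by rewrite D2 addrC.
  rewrite /allowed; case: {2}k (erefl k) => [kD _|kB]; last by rewrite kB eqxx.
  by rewrite DD1 // D2 addrC.
have off r r' : r \in [:: 0; o; t; o + t] -> r' \in [:: 0; o; t; o + t] ->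
    r' != r -> gram g r r' = 0.
  rewrite !inE => /or4P[] /eqP -> /or4P[] /eqP ->; rewrite ?eqxx // => _ //;
  by rewrite gramC.
split=> [q|q q'].
  have [r rl [->|->]] := indep_span q got; first exact: diag.
  by rewrite allowedD gramN gramC gramN opprK; apply: diag.
have [r rl rE] := indep_span q got; have [r' rl' rE'] := indep_span q' got.
suff: r' != r -> gram g q q' = 0.
  move=> h n1 n2; apply: h; apply: contraTneq isT => rr; rewrite -{}rr in rE.
  case: rE rE' n1 n2 => -> [] ->; rewrite ?eqxx // ?addKx ?eqxx //.
move=> rr; have E := off _ _ rl rl' rr.
by case: rE => ->; case: rE' => ->;
  rewrite ?gramN ?[gram g _ (g + _)]gramC ?gramN ?[gram g r' _]gramC ?E ?oppr0.
Qed.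

(** Row i is a signed sum of two orthogonal rows of square norm kap, both allowed since the weight
    of i is 2. It is also a times a coordinate row of square norm 4, so 2 kap = 4 a^2. *)
Lemma carries_sq g o t i j a kap : indep g o t -> carries f g o t i j a ->
  weight F k i = 2%:R -> weight F k j = 2%:R ->
  (forall q, allowed k g q -> gram g q q = kap) ->
  (forall q q', q' != q -> q' != g + q -> gram g q q' = 0) ->
  kap = 2%:R * a ^+ 2.
Proof.
move=> got R wi wj diag off; have := gram_xi got R R.
have al b : allowed k g (quad o t i.1 b).
  rewrite allowed_quad //; move: wi; rewrite /weight; case: k; case: i.1 => //.
  by move/eqP; rewrite -subr_eq0 -opprB oppr_eq0 addrK oner_eq0.
rewrite !diag // eqxx wj.
rewrite (off _ (quad o t i.1 true)) ?(quad_eq _ _ _ _ got) ?eqxx ?andbF //; last first.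
  by rewrite eq_sym (quad_eq _ _ _ _ got).
rewrite gramC off ?(quad_eq _ _ _ _ got) ?eqxx ?andbF //; last first.
  by rewrite eq_sym (quad_eq _ _ _ _ got).
rewrite -signr_addb addbb expr0 !mulr0 !addr0 mul1r => E.
apply: (mulfI two_neq0); rewrite -[2%:R * kap]/((1 + 1) * kap) mulrDl !mul1r E.
by rewrite /=; ring.
Qed.
End Gram.

(** * Normalization *)

Lemma touched_cross (C : numClosedFieldType) (e : pt -> pt -> C) x y : nice e -> e x y != 0 ->
  cross x y != 0.
Proof.
case=> eC e1 e0 _ exy; rewrite cross_neq0; apply/and3P; split; apply: contraNneq exy => ->;
  by rewrite ?e0 // ?[e x 0]eC ?e0 ?e1.
Qed.

Lemma indep_third g h : cross g h != 0 -> exists t, indep g h t.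
Proof.
move=> n0; pose P g h := (cross g h != 0) ==> has (indep g h) pts.
suff /all_ptsP/(_ g)/all_ptsP/(_ h) : all (fun g => all (P g) pts) pts.
  by rewrite /P n0 => /hasP[t _ ght]; exists t.
by vm_compute.
Qed.

Lemma indep_cross g h h' : cross g h != 0 -> cross g h' != 0 -> cross g h != cross g h' ->
  indep g h h'.
Proof.
move=> h1 h2 h3; pose P g h h' := [&& cross g h != 0, cross g h' != 0 & cross g h != cross g h']
   ==> indep g h h'.
have : P g h h' by move: g h h' {h1 h2 h3}; apply: all_pts3P; vm_compute.
by rewrite /P h1 h2 h3.
Qed.

Section Lines.
Variables (C : numClosedFieldType) (k : so_kind).
Notation so := (so_alg C k).
Variable f : {linear so -> so}.
Hypothesis f_homog : forall g x, homog g x -> homog g (f x).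
Hypothesis f_onto : forall g y, homog g y -> exists2 x, homog g x & f x = y.
Variables e e' : pt -> pt -> C.
Hypotheses (ne : nice e) (ne' : nice e').
Hypothesis e'0 : forall g h, e g h = 0 <-> e' g h = 0.
Hypothesis fbr : forall g h x y, homog g x -> homog h y ->
  e g h *: f (so_br x y) = e' g h *: so_br (f x) (f y).
Implicit Types (g h o p q t u n : pt) (i j : bool * bool).

Let two_neq0 : 2%:R != 0 :> C. Proof. by rewrite pnatr_eq0. Qed.

(** The conclusion is cyclic in g, h, g + h, so [line_carries] can be applied to whichever pair of
    the line lies in the support. *)
Lemma touched_carries g h t : indep g h t -> touched e g h ->
  forall i, valid k i -> exists j a1 a2 a3,
    [/\ carries f g h t i j a1, carries f h (g + h) t i j a2 & carries f (g + h) g t i j a3].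
Proof.
move=> ght.
have [hgt kgt] : indep h (g + h) t /\ indep (g + h) g t.
  by split; move: ght; apply/implyP; move: g h t; apply: all_pts3P; vm_compute.
have L a b : indep a b t -> e a b != 0 -> _ :=
  fun abt eab => line_carries two_neq0 f_homog f_onto abt eab
    (contra_not_neq (iffRL (e'0 a b)) (elimN eqP eab)) (@fbr a b).
have ghh : h + (g + h) = g by rewrite addrCA addxx addr0.
have ghg : g + h + g = h by rewrite addrC addKx.
have eC : forall a b : pt, e a b = e b a by case: ne.
case/or3P => egh i vi; first exact: L ght egh i vi.
  have [|j [a1 [a2 [a3 []]]]] := L _ _ kgt _ i vi; first by rewrite eC.
  by rewrite ghg; exists j, a2, a3, a1.
have [j [a1 [a2 [a3 []]]]] := L _ _ hgt egh i vi.
by rewrite ghh; exists j, a3, a1, a2.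
Qed.

Lemma touched_monomial g h t : indep g h t -> touched e g h -> monomial_on f g h t.
Proof.
move=> ght tgh i vi; have [j [a1 [a2 [a3 [R _ _]]]]] := touched_carries ght tgh vi.
by exists j, a1.
Qed.

(** Only the coordinate (false, false) can have weight 1. By [carries_inj] the coordinates (true,
    false) and (true, true) cannot both be carried to it. *)
Lemma touched_carries_weight g h t : indep g h t -> touched e g h ->
  exists i j a1 a2 a3, [/\ weight C k i = 2%:R, weight C k j = 2%:R &
    [/\ carries f g h t i j a1, carries f h (g + h) t i j a2 & carries f (g + h) g t i j a3]].
Proof.
move=> ght tgh.
have v s : valid k (true, s) by rewrite /valid; case: k.
have wt s : weight C k (true, s) = 2%:R by rewrite /weight; case: k.
have wj j : valid k j -> weight C k j = 2%:R \/ j = (false, false).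
  by rewrite /valid /weight; case: k => [_|]; [left|case: j => [[] []] //= _; [left|left|right]].
have [j [a1 [a2 [a3 [R1 R2 R3]]]]] := touched_carries ght tgh (v false).
have vj : valid k j by case: R1.
have [jw|j0] := wj j vj.
  by exists (true, false), j, a1, a2, a3.
have [j' [b1 [b2 [b3 [S1 S2 S3]]]]] := touched_carries ght tgh (v true).
have vj' : valid k j' by case: S1.
have [j'w|j'0] := wj j' vj'.
  by exists (true, true), j', b1, b2, b3.
by rewrite j0 in R1; rewrite j'0 in S1; have := carries_inj two_neq0 f_onto ght R1 S1.
Qed.

Definition point_on n g := exists2 h, cross g h = n & n != 0.

(* d.1 g is the entry of f at the point g of the line n, and d.2 the sign that
   remains in the comparison of e and e' along n. *)
Definition line_data n (d : (pt -> C) * bool) : Prop :=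
  (forall g h, cross g h = n -> e g h * d.1 (g + h) = (-1) ^+ d.2 * e' g h * (d.1 g * d.1 h)) /\
  (forall g, point_on n g -> d.1 g != 0 /\ exists h t i j,
     [/\ cross g h = n, indep g h t, carries f g h t i j (d.1 g),
         weight C k i = 2%:R & weight C k j = 2%:R]).

(** The same i and j serve at the three points, so [carries_edge] gives the same sign [i.2 (+) j.2]
    for the three pairs of the line. *)
Lemma line_data_exists n : n != 0 -> touched e (line_rep n).1 (line_rep n).2 ->
  exists d, line_data n d.
Proof.
move: (line_repP n); case: (line_rep n) => g h /= ghn n0 tgh.
have [t ght] : exists t, indep g h t by apply: indep_third; rewrite ghn.
have [hgt kgt] : indep h (g + h) t /\ indep (g + h) g t.
  by split; move: ght; apply/implyP; move: g h t {ghn tgh}; apply: all_pts3P; vm_compute.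
have [i [j [a1 [a2 [a3 [wi wj [R1 R2 R3]]]]]]] := touched_carries_weight ght tgh.
have ghh : h + (g + h) = g by rewrite addrCA addxx addr0.
have ghg : g + h + g = h by rewrite addrC addKx.
pose a (x : pt) := if x == g then a1 else if x == h then a2 else a3.
have /and3P[g0 h0 gh] : [&& g != 0, h != 0 & g != h] by rewrite -cross_neq0 ghn.
have ag : a g = a1 by rewrite /a eqxx.
have ah : a h = a2 by rewrite /a eqxx eq_sym (negbTE gh).
have ak : a (g + h) = a3.
  rewrite /a -[X in _ == X]addr0 (inj_eq (addrI g)) (negbTE h0).
  by rewrite -[X in _ == X]add0r (inj_eq (addIr h)) (negbTE g0).
have [eC e'C] : (forall a b : pt, e a b = e b a) /\ (forall a b : pt, e' a b = e' b a).
  by case: ne ne' => ? _ _ _ [].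
have sE (u v : C) : u * (-1) ^+ j.2 = v -> u = (-1) ^+ j.2 * v.
  by move=> <-; rewrite mulrCA -expr2 sqrr_sign mulr1.
have E1 := carries_edge two_neq0 f_homog ght (@fbr g h) R1 R2 R3.
have E2 : e h (g + h) * a1 * (-1) ^+ j.2 = e' h (g + h) * (-1) ^+ i.2 * (a2 * a3).
  apply: (carries_edge two_neq0 f_homog hgt (@fbr _ _) R2); first by rewrite ghh.
  by rewrite ghh.
have E3 : e (g + h) g * a2 * (-1) ^+ j.2 = e' (g + h) g * (-1) ^+ i.2 * (a3 * a1).
  by apply: (carries_edge two_neq0 f_homog kgt (@fbr _ _) R3); rewrite ghg.
exists (a, i.2 (+) j.2); split=> /= [p q pq|p [q pq _]].
  have {pq} : (p, q) \in line_pairs g h by apply: cross_eq; rewrite ghn.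
  have fin u v w (b1 b2 b3 : C) : e u v * b3 * (-1) ^+ j.2 = e' u v * (-1) ^+ i.2 * (b1 * b2) ->
      a u = b1 -> a v = b2 -> a w = b3 -> u + v = w ->
      (p, q) = (u, v) \/ (p, q) = (v, u) ->
      e p q * a (p + q) = (-1) ^+ (i.2 (+) j.2) * e' p q * (a p * a q).
    move=> + ub vb wb uv pq; rewrite -ub -vb -wb -uv signr_addb => E.
    have {}E : e u v * a (u + v) = (-1) ^+ i.2 * (-1) ^+ j.2 * e' u v * (a u * a v).
      by rewrite (sE _ _ E); ring.
    by case: pq => -[-> ->]; rewrite // eC e'C [v + u]addrC [a v * _]mulrC.
  rewrite !inE => /or4P[/eqP pq|/eqP pq|/eqP pq|/or3P[/eqP pq|/eqP pq|/eqP pq]].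
  - by apply: (fin g h (g + h)) E1 _ _ _ _ _ => //; left.
  - by apply: (fin g h (g + h)) E1 _ _ _ _ _ => //; right.
  - by apply: (fin (g + h) g h) E3 _ _ _ _ _ => //; right.
  - by apply: (fin (g + h) g h) E3 _ _ _ _ _ => //; left.
  - by apply: (fin h (g + h) g) E2 _ _ _ _ _ => //; left.
  - by apply: (fin h (g + h) g) E2 _ _ _ _ _ => //; right.
have [a10 a20 a30] : [/\ a1 != 0, a2 != 0 & a3 != 0] by case: R1 R2 R3 => _ _ ? _ [_ _ ? _] [].
have chn : cross h (g + h) = n by rewrite addrC crossxD crossC.
have ckn : cross (g + h) g = n by rewrite crossC crossxD.
have : (p, q) \in line_pairs g h by apply: cross_eq; rewrite ghn.
have D1 : a g != 0 /\ exists h0 t i j, [/\ cross g h0 = n, indep g h0 t,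
    carries f g h0 t i j (a g), weight C k i = 2%:R & weight C k j = 2%:R].
  by rewrite ag; split=> //; exists h, t, i, j.
have D2 : a h != 0 /\ exists h0 t i j, [/\ cross h h0 = n, indep h h0 t,
    carries f h h0 t i j (a h), weight C k i = 2%:R & weight C k j = 2%:R].
  by rewrite ah; split=> //; exists (g + h), t, i, j.
have D3 : a (g + h) != 0 /\ exists h0 t i j, [/\ cross (g + h) h0 = n, indep (g + h) h0 t,
    carries f (g + h) h0 t i j (a (g + h)), weight C k i = 2%:R & weight C k j = 2%:R].
  by rewrite ak; split=> //; exists g, t, i, j.
by rewrite !inE !xpair_eqE => /or4P[| | |/or3P[| |]] /andP[/eqP-> _].
Qed.

(** Both squares are half of the Gram constant of f on L_g. *)
Lemma two_lines g n n' d d' : n != 0 -> n' != 0 ->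
  touched e (line_rep n).1 (line_rep n).2 -> touched e (line_rep n').1 (line_rep n').2 ->
  line_data n d -> line_data n' d' -> point_on n g -> point_on n' g -> n != n' ->
  d.1 g ^+ 2 = d'.1 g ^+ 2.
Proof.
move=> n0 n'0 tn tn' [_ D] [_ D'] gn gn' nn'.
have [_ [h [t [i [j [hn ght R wi wj]]]]]] := D _ gn.
have [_ [h' [t' [i' [j' [hn' ght' R' wi' wj']]]]]] := D' _ gn'.
have [ghh' gh'h] : indep g h h' /\ indep g h' h.
  by split; apply: indep_cross; rewrite ?hn ?hn' // 1?eq_sym.
have lt := touched_line_fun ne.
have T : touched e g h.
  by rewrite (line_fun_cross lt _ _ (y := (line_rep n).2) (x := (line_rep n).1)) ?line_repP.
have T' : touched e g h'.
  by rewrite (line_fun_cross lt _ _ (y := (line_rep n').2) (x := (line_rep n').1)) ?line_repP.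
have [kap [K1 K2]] := gram_two_lines two_neq0 f_onto ghh'
  (touched_monomial ghh' T) (touched_monomial gh'h T').
have := carries_sq two_neq0 ght R wi wj K1 K2.
by rewrite (carries_sq two_neq0 ght' R' wi' wj' K1 K2) => /(mulfI two_neq0).
Qed.

Lemma normalization : exists al : pt -> C, (forall g, al g != 0) /\
  forall g h, e' g h = e g h * (al g * al h / al (g + h)).
Proof.
pose tch n := (n != 0) && touched e (line_rep n).1 (line_rep n).2.
have /choice[d dP] : forall n, exists d, tch n -> line_data n d.
  move=> n; have [/andP[n0 tn]|_] := boolP (tch n); last by exists (fun _ => 0, false).
  by have [d] := line_data_exists n0 tn; exists d.
(* The common value of the squares at g, or 1 by default when no touched line passes through g. *)
have /choice[q qP] : forall g, exists q : C, q != 0 /\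
    forall n, tch n -> point_on n g -> (d n).1 g ^+ 2 = q.
  move=> g; have [[n tn ng]|no] := pselect (exists2 n, tch n & point_on n g); last first.
    by exists 1; split=> [|n tn ng]; [rewrite oner_neq0|case: no; exists n].
  exists ((d n).1 g ^+ 2); split=> [|n' tn' ng'].
    by have [_ D] := dP _ tn; rewrite expf_neq0 //; case: (D _ ng).
  have [->//|nn'] := eqVneq n' n; have /andP[n0 tn0] := tn; have /andP[n'0 tn'0] := tn'.
  exact: two_lines (dP _ tn') (dP _ tn) ng' ng nn'.
pose al g := sqrtC (q g).
have al0 g : al g != 0 by rewrite sqrtC_eq0; case: (qP g).
pose s n g := (d n).1 g != al g.
have sP n g : tch n -> point_on n g -> (d n).1 g = (-1) ^+ s n g * al g.
  move=> tn ng; rewrite /s; have [->|ne_al] := eqVneq ((d n).1 g) (al g).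
    by rewrite expr0 mul1r.
  have : (d n).1 g ^+ 2 == al g ^+ 2 by rewrite sqrtCK; case: (qP g) => _ ->.
  by rewrite eqf_sqr (negbTE ne_al) => /eqP ->; rewrite expr1 mulN1r.
(* The sign of the line, corrected by the signs s by which the entries differ from the chosen square
   roots; evaluating at [line_rep] makes it depend on the line only. *)
pose S g h := let n := cross g h in let: (u, v) := line_rep n in
  (d n).2 (+) (s n u (+) s n v (+) s n (u + v)).
have lS : line_fun S by split=> g h; rewrite /S ?crossxD // crossC.
have [eC e1 e0 eJ] := ne; have [e'C e'1 e'00 e'J] := ne'.
have main g h : e g h * al (g + h) = (-1) ^+ S g h * e' g h * (al g * al h).
  have [eg0|egh] := eqVneq (e g h) 0; first by rewrite eg0 (iffLR (e'0 g h) eg0) mulr0 !mul0r.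
  have n0 := touched_cross ne egh; pose n := cross g h.
  have tn : tch n.
    rewrite /tch n0; have lt := touched_line_fun ne.
    by rewrite (line_fun_cross lt n0) ?line_repP // /touched egh.
  have [D _] := dP _ tn; have := D g h erefl.
  have gn : point_on n g by exists h.
  have hn : point_on n h by exists g; rewrite // crossC.
  have ghn : point_on n (g + h) by exists g; rewrite // crossC crossxD.
  rewrite !sP // /S -/n.
  have ls : line_fun (fun u v => s n u (+) s n v (+) s n (u + v)).
    split=> u v; first by rewrite [u + v]addrC [s n u (+) _]addbC.
    by rewrite addKx -!addbA [s n v (+) _]addbC.
  have := line_fun_cross ls n0 (line_repP n); case: (line_rep n) => u v /= ->.
  rewrite !signr_addb => E; apply: (mulfI (_ : (-1) ^+ s n (g + h) != 0));
    first by rewrite signr_eq0.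
  rewrite mulrCA E.
  rewrite [RHS](_ : _ = (-1) ^+ s n (g + h) ^+ 2 * ((-1) ^+ (d n).2 * e' g h *
    ((-1) ^+ s n g * al g * ((-1) ^+ s n h * al h)))); last by ring.
  by rewrite sqrr_sign mul1r.
(* A normalization of e' from which e differs by the line sign S alone, so that [coboundary_sign]
   applies. *)
pose e2 g h := e' g h * (al g * al h / al (g + h)).
have eE g h : e g h = signed S e2 g h.
  by apply: (mulIf (al0 (g + h))); rewrite main /signed /e2; field; rewrite al0.
have ne2 : nice e2.
  split=> [g h|g|g|g h l ghl]; rewrite /e2 ?e'1 ?e'00 ?mul0r //.
    by rewrite e'C [al g * _]mulrC [g + h]addrC.
  rewrite mulrACA [RHS]mulrACA e'J // [l + (g + h)]addrC -[g + h + l]addrA; congr (_ * _).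
  by field; rewrite !al0.
have ns2 : nice (signed S e2).
  have -> : signed S e2 = e by apply/funext => g; apply/funext => h; rewrite eE.
  exact: ne.
have [be [be0 beE]] := coboundary_sign ne2 ns2 lS.
(* Both al and be normalize from e' to e, hence the inverse. *)
exists (fun g => (al g * be g)^-1); split=> [g|g h]; first by rewrite invr_eq0 mulf_neq0.
rewrite eE /signed mulrC [_ * e2 g h]mulrC beE /e2.
by field; rewrite !al0 !be0.
Qed.
End Lines.

(** * Normalization implies strong equivalence *)

Section NormToStrong.
Variables (F : fieldType) (k : so_kind).
Notation so := (so_alg F k).
Implicit Types (x y z : so) (g h : Z2_3) (c : Z2_3 -> F).

Lemma so_compD g a x y : so_comp g (a *: x + y) = a *: so_comp g x + so_comp g y.
Proof.
apply/val_inj/lfunP => v; rewrite /= add_lfunE scale_lfunE !hcompE scaler_sumr -big_split /=.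
by apply: eq_bigr => h _; rewrite add_lfunE scale_lfunE linearP.
Qed.

Definition grade_scale c x : so := \sum_g c g *: so_comp g x.

Lemma grade_scale_linear c : linear (grade_scale c).
Proof.
move=> a x y; rewrite /grade_scale scaler_sumr -big_split /=; apply: eq_bigr => g _.
by rewrite so_compD scalerDr scalerA [c g * a]mulrC -scalerA.
Qed.

HB.instance Definition _ c :=
  GRing.isLinear.Build F so so _ (grade_scale c) (grade_scale_linear c).

Lemma grade_scale_homog c g x : Lgrad F k g x -> grade_scale c x = c g *: x.
Proof.
move=> xg; rewrite /grade_scale (bigD1 g) //= (so_comp_homog _ xg) eqxx big1 ?addr0 // => h hg.
by rewrite (so_comp_homog _ xg) (negbTE hg) scaler0.
Qed.

Lemma so_comp_scale c g x : so_comp g (grade_scale c x) = c g *: so_comp g x.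
Proof.
have comp0 h : so_comp h (0 : so) = 0.
  by rewrite -[0 in LHS](subrr 0) -scaleN1r addrC so_compD scaleN1r addNr.
have compZ h a y : so_comp h (a *: y) = a *: so_comp h y.
  by rewrite -[a *: y]addr0 so_compD comp0 addr0.
have compD h : {morph (so_comp h : so -> so) : u v / u + v}.
  by move=> u v; rewrite -[u]scale1r so_compD !scale1r.
rewrite /grade_scale (big_morph _ (compD g) (comp0 g)) (bigD1 g) //= big1 ?addr0 => [|h hg].
  by rewrite compZ (so_comp_homog _ (so_comp_in g x)) eqxx.
by rewrite compZ (so_comp_homog _ (so_comp_in h x)) eq_sym (negbTE hg) scaler0.
Qed.

Lemma grade_scaleK c c' : (forall g, c' g * c g = 1) -> cancel (grade_scale c) (grade_scale c').
Proof.
move=> cc x; rewrite -[RHS]sum_so_comp; apply: eq_bigr => g _.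
by rewrite so_comp_scale scalerA cc scale1r.
Qed.

Lemma so_brZ a a' x y : so_br (a *: x) (a' *: y) = (a * a') *: so_br x y.
Proof.
apply/val_inj/lfunP => v.
rewrite /= !(scale_lfunE, add_lfunE, opp_lfunE, comp_lfunE) /= ?scale_lfunE !linearZ /=.
by rewrite -!scalerDr scalerA mulrC.
Qed.

Lemma norm_strong (eps eps' : Z2_3 -> Z2_3 -> F) : norm_equiv eps eps' -> strong_equiv k eps eps'.
Proof.
(* Scaling degree g by c turns eps into eps(g,h) c(g+h) / (c(g) c(h)), so c must be the inverse of
   al. *)
move=> [al [al0 epsE]]; pose c g := (al g)^-1.
have cK : cancel (grade_scale c) (grade_scale al).
  by apply: grade_scaleK => g; rewrite mulfV.
have Kc : cancel (grade_scale al) (grade_scale c).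
  by apply: grade_scaleK => g; rewrite mulVf.
exists (grade_scale c); split.
  split; [exact: grade_scale_linear|by exists (grade_scale al)|move=> x y].
  rewrite /contr_br linear_sum; apply: eq_bigr => g _; rewrite linear_sum.
  apply: eq_bigr => h _; rewrite linearZ /= !so_comp_scale so_brZ scalerA.
  have [p pg] := deg_surj g; have [q qh] := deg_surj h.
  have B : Lgrad F k (g + h) (so_br (so_comp g x) (so_comp h y)).
    by rewrite -pg -qh -degD; apply: homog_br; apply: so_comp_in.
  rewrite (grade_scale_homog c B) scalerA; congr (_ *: _).
  by rewrite epsE /c; field; rewrite !al0.
move=> g; apply/seteqP; split=> [_ [x xg <-]|y yg].
  by rewrite /= (grade_scale_homog c xg) => h v vh; rewrite scale_lfunE rpredZ ?xg.
exists (grade_scale al y); last exact: Kc.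
by rewrite (grade_scale_homog al yg) => h v vh; rewrite scale_lfunE rpredZ ?yg.
Qed.
End NormToStrong.

(** * Strong equivalence implies normalization *)

Lemma strong_norm (C : numClosedFieldType) (k : so_kind) (eps eps' : Z2_3 -> Z2_3 -> C) :
  graded_contraction k eps -> admissible eps ->
  graded_contraction k eps' -> admissible eps' ->
  strong_equiv k eps eps' -> norm_equiv eps eps'.
Proof.
move=> ce ae ce' ae' [f0 [[f_lin f_bij f_br] f_img]].
pose f : {linear so_alg C k -> so_alg C k} :=
  HB.pack f0 (GRing.isLinear.Build _ _ _ _ f0 f_lin).
have fE x : f x = f0 x by [].
have f_homog g x : homog g x -> homog g (f x).
  by move=> xg; rewrite /homog -[Lgrad C k (deg g)]f_img; exists x.
have f_onto g y : homog g y -> exists2 x, homog g x & f x = y.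
  by rewrite /homog -{1}[Lgrad C k (deg g)]f_img => -[x xg <-]; exists x.
pose e g h := eps (deg g) (deg h); pose e' g h := eps' (deg g) (deg h).
have ne : nice e by exact: contr_nice ce ae.
have ne' : nice e' by exact: contr_nice ce' ae'.
have fbr g h x y : homog g x -> homog h y ->
    e g h *: f (so_br x y) = e' g h *: so_br (f x) (f y).
  move=> xg yh; rewrite -linearZ -(contr_br_deg eps xg yh) /=.
  by rewrite -(contr_br_deg eps' (f_homog _ _ xg) (f_homog _ _ yh)) /= f_br.
(* The supports agree: a nonzero bracket of degrees g, h is tested through preimages under f in one
   direction and through injectivity of f in the other. *)
have e'0 g h : e g h = 0 <-> e' g h = 0.
  have deg_case : (g != 0) && (h != 0) && (g != h) \/ e g h = 0 /\ e' g h = 0.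
    case: ne ne' => eC e1 e0 _ [e'C e'1 e'0 _].
    have [->|g0] := eqVneq g 0; first by right.
    have [->|h0] := eqVneq h 0; first by right; rewrite eC e'C.
    by have [->|gh] := eqVneq g h; [right|left].
  case: deg_case => [/andP[/andP[g0 h0] gh]|[-> ->] //].
  have b0 := so_br_neq0 C k g0 h0 gh.
  set x := unit_so C k g h in b0; set y := unit_so C k h (g + h) in b0.
  have xg : homog g x by exact: unit_homog.
  have yh : homog h y by exact: unit_homog.
  split=> E.
    have [x' xg' xE] := f_onto _ _ xg; have [y' yh' yE] := f_onto _ _ yh.
    have := fbr _ _ _ _ xg' yh'; rewrite xE yE E scale0r => /esym/eqP.
    by rewrite scaler_eq0 (negbTE b0) orbF => /eqP.
  have := fbr _ _ _ _ xg yh; rewrite E scale0r => /eqP; rewrite scaler_eq0 => /orP[/eqP //|].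
  have f_inj := bij_inj f_bij.
  by rewrite -(linear0 f) => /eqP/f_inj/eqP; rewrite (negbTE b0).
have [al [al0 alE]] := normalization f_homog f_onto ne ne' e'0 fbr.
have /choice[r rK] := deg_surj.
exists (al \o r); split=> [g|g h]; first exact: al0.
have rD : r (g + h) = r g + r h by apply: deg_inj; rewrite degD !rK.
by have := alE (r g) (r h); rewrite /e /e' !rK /= rD.
Qed.

Theorem theorem3p13 (R : realType) (k : so_kind)
    (eps eps' : Z2_3 -> Z2_3 -> R[i]) :
  graded_contraction k eps -> admissible eps ->
  graded_contraction k eps' -> admissible eps' ->
  (strong_equiv k eps eps' <-> norm_equiv eps eps').
Proof.
move=> ce ae ce' ae'; split; first exact: strong_norm.
exact: norm_strong.
Qed.
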